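(* Let $H$ be a separable infinite-dimensional Hilbert space, $\alpha:\mathcal B(H)\to\mathcal B(H)$ an endomorphism of index $n=\infty$, and $\{U_i\}_{i\in\mathbb N}$ a family of isometries on $H$ with mutually orthogonal ranges such that $\alpha(a)=\sum_{i=1}^\infty U_iaU_i^*$ (weakly convergent) for all $a\in\mathcal B(H)$. For every positive finite finitely additive measure $\mu$ on $\mathbb N$ the formula $$\mathcal L(a)=\int_{\mathbb N}U_i^*aU_i\,d\mu(i),\qquad a\in\mathcal B(H),$$ defines a transfer operator for $(\mathcal B(H),\alpha)$. Moreover, $\|\mathcal L\|=\mu(\mathbb N)$ and: (i) $\mathcal L$ is singular if and only if $\mu$ has no atoms, i.e. $\mu(\{i\})=0$ for all $i\in\mathbb N$. (ii) The positive linear functional $\omega$ on $\mathcal B(H_\infty)$ associated with $\mathcal L$, i.e. determined by $\mathcal L(1\otimes b)=\omega(b)1$ for $b\in\mathcal B(H_\infty)$, is diagonalizable; namely $\omega(b)=\int_{\mathbb N}\langle be_i,e_i\rangle\,d\mu(i)$ for $b\in\mathcal B(H_\infty)$. (iii) $\mathcal L$ is non-degenerate if and only if $\mu(\mathbb N)=1$, and then the conditional expectation $E=\alpha\circ\mathcal L$ is given by $E(a)=\sum_{j=1}^\infty\int_{\mathbb N}U_jU_i^*aU_iU_j^*\,d\mu(i)$, $a\in\mathcal B(H)$.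
   Context: An endomorphism is a $*$-homomorphism, not assumed to be unital. Every non-zero endomorphism of $\mathcal B(H)$ ($H$ separable) can be written as $\alpha(a)=\sum_{i=1}^nU_iaU_i^*$ with isometries $U_i$ having mutually orthogonal ranges; the number $n\in\{1,2,\dots,\infty\}$ is the index of $\alpha$. $H_\infty$ is a separable infinite-dimensional Hilbert space with a fixed orthonormal basis $\{e_i\}_{i\in\mathbb N}$; for $b\in\mathcal B(H_\infty)$ put $b(i,j)=\langle be_j,e_i\rangle$ and let $1\otimes b$ denote the operator $\sum_{i,j=1}^\infty b(i,j)U_iU_j^*\in\alpha(1)\mathcal B(H)\alpha(1)$ (weakly convergent sum). For a bounded function $\phi:\mathbb N\to\mathcal B(H)$, $\int_{\mathbb N}\phi(i)\,d\mu(i)$ denotes the unique bounded operator with $\langle\int_{\mathbb N}\phi(i)\,d\mu(i)\,x,y\rangle=\int_{\mathbb N}\langle\phi(i)x,y\rangle\,d\mu(i)$ for all $x,y\in H$, where the integral of a bounded scalar sequence against the finitely additive measure $\mu$ (defined on all subsets of $\mathbb N$) is the usual one, giving a positive functional on $\ell^\infty$. The sum over $j$ in (iii) is weakly convergent. A transfer operator for $(\mathcal B(H),\alpha)$ is a continuous positive linear map $\mathcal L:\mathcal B(H)\to\mathcal B(H)$ with $\mathcal L(\alpha(a)b)=a\mathcal L(b)$ for all $a,b$; it is non-degenerate if $\alpha(\mathcal L(1))=\alpha(1)$, in which case $\alpha\circ\mathcal L$ is a conditional expectation onto $\alpha(\mathcal B(H))$. $\mathcal L$ is singular if it annihilates all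 compact operators on $H$. *)

(* Defs.v *)
From HB Require Import structures.
From mathcomp Require Import all_boot all_order all_algebra.
From mathcomp Require Import all_classical all_reals all_analysis.
From mathcomp Require Import complex.

Set Implicit Arguments.
Unset Strict Implicit.
Unset Printing Implicit Defensive.

Import Order.TTheory GRing.Theory Num.Theory Num.Def.
Import numFieldNormedType.Exports.

Local Open Scope classical_set_scope.
Local Open Scope ring_scope.

(* The scalar field is R[i] (R : realType); norms of vectors take their values
   in R[i] and are nonnegative reals there. The inner product is linear in the
   first argument and conjugate linear in the second one. *)
HB.mixin Record isHilbert (R : realType) H & CompleteNormedModule R[i] H := {
  inner : {dot H for @conjC R[i]} ;
  inner_normE : forall x : H, inner x x = `|x| ^+ 2
}.

#[short(type="hilbertType")]
HB.structure Definition Hilbert (R : realType) :=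
  {H of isHilbert R H & CompleteNormedModule R[i] H}.

Notation "'[ x , y ]" := (inner x%R y%R) : ring_scope.

Section OperatorNorm.
Variables (R : realType) (V W : normedModType R[i]).

Definition opnorm (f : V -> W) : R :=
  sup [set complex.Re `|f x| | x in [set x : V | `|x| <= 1]].

Let normE (U : normedModType R[i]) (x : U) : (complex.Re `|x|)%:C%C = `|x|.
Proof. by rewrite RRe_real// ger0_real. Qed.

Variable f : V -> W.
Hypotheses (lf : linear f) (cf : continuous f).

Let g : {linear V -> W} := HB.pack f (GRing.isLinear.Build _ _ _ _ _ lf).

Let f0 : f 0 = 0. Proof. exact: (linear0 g). Qed.

Let opnorm_has_sup :
  has_sup [set complex.Re `|f x| | x in [set x : V | `|x| <= 1]].
Proof.
split; first by exists (complex.Re `|f 0|), 0 => //=; rewrite normr0.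
have /linear_bounded_continuous/linear_boundedP/pinfty_ex_gt0[M M0 Mf] :
  continuous g by [].
exists (complex.Re M) => _ [x x1 <-].
rewrite -lecR normE RRe_real ?gtr0_real//.
by rewrite (le_trans (Mf x))// ger_pMr.
Qed.

Lemma opnormP x : `|f x| <= (opnorm f)%:C%C * `|x|.
Proof.
have [->|x0] := eqVneq x 0; first by rewrite f0 !normr0 mulr0.
have nx0 : 0 < `|x| by rewrite normr_gt0.
rewrite -ler_pdivrMr// -[X in X / _]/(`|g x|).
have -> : `|g x| / `|x| = `|f (`|x|^-1 *: x)|.
  by rewrite -[f]/(g : V -> W) linearZ normrZ normfV normr_id mulrC.
rewrite -normE lecR; apply: ub_le_sup; first by case: opnorm_has_sup.
by eexists => //=; rewrite normrZ normfV normr_id mulVf// gt_eqF.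
Qed.

Lemma opnorm_le (M : R) : (forall x, `|x| <= 1 -> `|f x| <= M%:C%C) ->
  opnorm f <= M.
Proof.
move=> fM; apply: ge_sup; first by case: opnorm_has_sup.
by move=> _ [x x1 <-]; rewrite -lecR normE fM.
Qed.

Lemma opnorm_ge0 : 0 <= opnorm f.
Proof.
apply: le_trans (_ : complex.Re `|f 0| <= _); first by rewrite f0 normr0.
apply: ub_le_sup; first by case: opnorm_has_sup.
by exists 0 => //=; rewrite normr0.
Qed.

End OperatorNorm.

Section Bop.
Variables (R : realType) (V : normedModType R[i]).

Definition bounded_operator : {pred V -> V} :=
  fun f => `[< linear f /\ continuous f >].

Lemma bounded_operator_submod : submod_closed bounded_operator.
Proof.
split.
  apply/asboolP; split; first by move=> a x y; rewrite scaler0 addr0.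
  exact: cst_continuous.
move=> a f g /asboolP[lf cf] /asboolP[lg cg]; apply/asboolP; split.
  move=> b x y; rewrite /= !fctE/= lf lg !scalerDr !scalerA (mulrC a).
  by rewrite addrACA.
by move=> x; apply: cvgD; [apply: cvgZr; exact: cf|exact: cg].
Qed.

HB.instance Definition _ :=
  GRing.isSubmodClosed.Build _ _ bounded_operator bounded_operator_submod.

Record bop := Bop { bop_fun :> V -> V; bop_funP : bop_fun \in bounded_operator }.

HB.instance Definition _ := [isSub for bop_fun].
HB.instance Definition _ := [Choice of bop by <:].
HB.instance Definition _ := [SubChoice_isSubLmodule of bop by <:].

Implicit Types a b c : bop.

Lemma bopP a b : a =1 b -> a = b.
Proof. by move=> ab; apply/val_inj/funext. Qed.

Lemma bop_linear a : linear a. Proof. by have /asboolP[] := bop_funP a. Qed.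

HB.instance Definition _ a :=
  GRing.isLinear.Build R[i] V V *:%R a (@bop_linear a).

Lemma bop_continuous a : continuous a.
Proof. by have /asboolP[] := bop_funP a. Qed.

Let bop1P : id \in bounded_operator.
Proof. by apply/asboolP; split => // x; exact: cvg_id. Qed.

Let bopMP a b : a \o b \in bounded_operator.
Proof.
apply/asboolP; split => [k x y|x]; first by rewrite /= !linearP.
by apply: continuous_comp; exact: bop_continuous.
Qed.

Let mul a b := Bop (bopMP a b).

Let bop1 := Bop bop1P.

Let mulA : associative mul. Proof. by move=> a b c; exact: bopP. Qed.
Let mul1 : left_id bop1 mul. Proof. by move=> a; exact: bopP. Qed.
Let mulr1 : right_id bop1 mul. Proof. by move=> a; exact: bopP. Qed.
Let mulDl : left_distributive mul +%R.
Proof. by move=> a b c; exact: bopP. Qed.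
Let mulDr : right_distributive mul +%R.
Proof. by move=> a b c; apply: bopP => x; exact: (linearD a). Qed.

HB.instance Definition _ :=
  GRing.Zmodule_isPzRing.Build bop mulA mul1 mulr1 mulDl mulDr.

Let norm a : R[i] := (opnorm a)%:C%C.

Let normP a x : `|a x| <= norm a * `|x|.
Proof. exact: opnormP (@bop_linear a) (@bop_continuous a) x. Qed.

Let norm_ge0 a : 0 <= norm a.
Proof. by rewrite ler0c opnorm_ge0//; [exact: bop_linear|exact: bop_continuous]. Qed.

Let norm_le a (M : R[i]) : 0 <= M ->
  (forall x, `|x| <= 1 -> `|a x| <= M) -> norm a <= M.
Proof.
move=> M0 aM; rewrite -[M]RRe_real ?ger0_real// lecR.
apply: opnorm_le; [exact: bop_linear|exact: bop_continuous|].
by move=> x /aM; rewrite RRe_real ?ger0_real.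
Qed.

Let ler_normD a b : norm (a + b) <= norm a + norm b.
Proof.
apply: norm_le => [|x x1]; first by rewrite addr_ge0.
rewrite (le_trans (ler_normD _ _))// lerD// (le_trans (normP _ _))//.
  by rewrite ler_piMr.
by rewrite ler_piMr.
Qed.

Let normZ_le (k : R[i]) a : norm (k *: a) <= `|k| * norm a.
Proof.
apply: norm_le => [|x x1]; first by rewrite mulr_ge0.
rewrite normrZ ler_wpM2l// (le_trans (normP _ _))//.
by rewrite ler_piMr.
Qed.

Let normrZ (k : R[i]) a : norm (k *: a) = `|k| * norm a.
Proof.
apply/eqP; rewrite eq_le normZ_le/=.
have [->|k0] := eqVneq k 0; first by rewrite normr0 mul0r.
rewrite mulrC -ler_pdivlMr ?normr_gt0// -{1}(scalerK k0 a) mulrC.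
by rewrite (le_trans (normZ_le _ _))// normfV.
Qed.

Let normr0_eq0 a : norm a = 0 -> a = 0.
Proof.
move=> a0; apply: bopP => x; apply/eqP.
by rewrite -normr_le0 (le_trans (normP _ _))// a0 mul0r.
Qed.

HB.instance Definition _ :=
  Lmodule_isNormed.Build R[i] bop ler_normD normrZ normr0_eq0.

Lemma bop_normE a : `|a| = (opnorm a)%:C%C. Proof. by []. Qed.

Lemma bop_mulE a b x : (a * b) x = a (b x). Proof. by []. Qed.

Lemma bop_oneE x : (1 : bop) x = x. Proof. by []. Qed.

End Bop.

(* Integral of a bounded complex sequence. The library integral is defined for
   an arbitrary set function, not only for sigma-additive ones: for f >= 0 it is
   the supremum of the integrals of the simple functions below f. *)
Definition Cintegral (R : realType) (mu : {content set nat -> \bar R})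
    (f : nat -> R[i]) : R[i] :=
  Complex (fine (\int[mu]_i (complex.Re (f i))%:E)%E)
          (fine (\int[mu]_i (complex.Im (f i))%:E)%E).

Section Operators.
Variables (R : realType) (H : hilbertType R).
Implicit Types (a b T : bop H) (mu : {content set nat -> \bar R}).

Definition separable_space := exists D : set H, countable D /\ dense D.

Definition infinite_dimensional := forall (n : nat) (v : 'I_n -> H),
  exists x : H, forall c : 'I_n -> R[i], x != \sum_i c i *: v i.

Definition hilbert_basis (e : nat -> H) :=
  (forall i j, '[e i, e j] = (i == j)%:R) /\
  (forall x, series (fun i => '[x, e i] *: e i) n @[n --> \oo] --> x).

Definition is_adjoint a b := forall x y, '[a x, y] = '[x, b y].

(* Total by choice; the adjoint exists (Riesz) and is unique. *)
Definition adjoint a : bop H := xget 0 [set b | is_adjoint a b].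

Definition positive_op a := forall x, 0 <= '[a x, x].

Definition compact_op a := precompact [set a x | x in [set x : H | `|x| <= 1]].

Definition isometry_op a := forall x, `|a x| = `|x|.

Definition weak_cvg (I : Type) (F : set_system I) (T : I -> bop H) a :=
  forall x y, '[T i x, y] @[i --> F] --> ('[a x, y] : R[i]^o).

Definition weak_sum (T : nat -> bop H) a := weak_cvg \oo (series T) a.

Definition is_op_integral mu (phi : nat -> bop H) a :=
  forall x y, '[a x, y] = Cintegral mu (fun i => '[phi i x, y]).

Definition op_integral mu (phi : nat -> bop H) : bop H :=
  xget 0 [set a | is_op_integral mu phi a].

(* A *-homomorphism, not necessarily unital. *)
Definition endomorphism (alpha : bop H -> bop H) :=
  [/\ linear alpha, {morph alpha : a b / a * b}
    & {morph alpha : a / adjoint a}].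

(* alpha is implemented by the infinite family U; its index is infinite. *)
Definition implements (U : nat -> bop H) (alpha : bop H -> bop H) :=
  [/\ forall i, isometry_op (U i),
      forall i j x y, i != j -> '[U i x, U j y] = 0
    & forall a, weak_sum (fun i => U i * a * adjoint (U i)) (alpha a)].

Definition positive_map (L : bop H -> bop H) :=
  forall a, positive_op a -> positive_op (L a).

Definition transfer_operator (alpha L : bop H -> bop H) :=
  [/\ linear L, continuous L, positive_map L
    & forall a b, L (alpha a * b) = a * L b].

Definition nondegenerate_transfer (alpha L : bop H -> bop H) :=
  alpha (L 1) = alpha 1.

Definition singular_map (L : bop H -> bop H) := forall a, compact_op a -> L a = 0.

Definition conditional_expectation (B : set (bop H)) (E : bop H -> bop H) :=
  [/\ linear E /\ positive_map E,
      forall a, `|E a| <= `|a|,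
      forall a, B (E a),
      forall b, B b -> E b = b
    & forall a b, B b -> E (b * a) = b * E a /\ E (a * b) = E a * b].

Definition positive_functional (omega : bop H -> R[i]) :=
  scalar omega /\ forall a, positive_op a -> 0 <= omega a.

Definition diagonal_functional (e : nat -> H) mu (b : bop H) : R[i] :=
  Cintegral mu (fun i => '[b (e i), e i]).

Definition diagonalizable_functional (omega : bop H -> R[i]) :=
  exists (e : nat -> H) (mu : {content set nat -> \bar R}),
    [/\ hilbert_basis e, (mu setT < +oo)%E
      & forall b, omega b = diagonal_functional e mu b].

End Operators.

(* The operator 1 (x) b attached to the isometries U and the basis e of K; the
   double series is summed over rectangles i < m, j < n as m, n --> oo. *)
Definition tensor1 (R : realType) (H K : hilbertType R) (U : nat -> bop H)
    (e : nat -> K) (b : bop K) : bop H :=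
  xget 0 [set a | weak_cvg (filter_prod \oo \oo)
    (fun mn : nat * nat => \sum_(0 <= i < mn.1) \sum_(0 <= j < mn.2)
       '[b (e j), e i] *: (U i * adjoint (U j))) a].

Definition associated_functional (R : realType) (H K : hilbertType R)
    (U : nat -> bop H) (e : nat -> K) (L : bop H -> bop H)
    (omega : bop K -> R[i]) :=
  forall b, L (tensor1 U e b) = omega b *: (1 : bop H).

(* Main.v *)
(* For finitely additive [mu] no convergence theorem is available, but the
   integral of a bounded function is squeezed between the integrals of simple
   functions below and above it, and a bounded function is a uniform limit of
   such functions; this makes the integral linear and bounded by [mu setT].
   Hence (a, x, y) |-> int <a U_i x, U_i y> is a bounded sesquilinear form in
   (x, y), and the Riesz theorem gives L(a). The relations
   U_i^* U_j = delta_ij, alpha(a) U_i = U_i a and U_i^* alpha(a) = a U_i^* give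
   the transfer identity and L(1) = mu(N) 1, which settles the norm and the
   non-degenerate case.
   For compact a, U_i x tends weakly to 0, so {i : |a U_i x| > e} is finite and
   mu-null when there are no atoms; conversely the rank-one projection on
   U_j h detects mu({j}).
   The double series of 1 (x) b converges because its partial sums are uniformly
   bounded by |b| |x| |y| (expand the U_j^* x in an orthonormal family) and
   sum_k |U_k^* x|^2 converges; its compression by U_k is <b e_k, e_k> 1. *)

(* Adjoints, operator integrals and [tensor1] are chosen by [xget] with default 0, so nothing can be
   computed before existence is proved; [form_op] is the common source of existence, turning a
   bounded sesquilinear form into an operator. The map [alpha] is known only through weak limits of
   partial sums. Its algebraic relations with the [U i] come from testing against vectors of the
   form U_i y: all terms but one vanish, the tested sums are eventually constant, and the limit is
   read off. For the double series, the natural estimate of a rectangle has (|x|^2 + |y|^2)/2 in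
   place of |x| |y|, since it is obtained termwise from the inequality between the two means;
   rescaling x and y to norm 1 restores the product. Truncating an index range is the same as
   projecting a vector onto finitely many ranges of the [U i], so the uniform bound alone yields the
   Cauchy property. *)
From HB Require Import structures.
Require Import Defs.
From mathcomp Require Import all_boot all_order all_algebra.
From mathcomp Require Import all_classical all_reals all_analysis.
From mathcomp Require Import complex.
From mathcomp Require Import zify ring lra.
Import Order.TTheory GRing.Theory Num.Theory.
Import numFieldNormedType.Exports.
Local Open Scope classical_set_scope.
Local Open Scope ring_scope.

(** * Integration of bounded real sequences against a finite content *)

Section FiniteContent.
Set Implicit Arguments.
Unset Strict Implicit.
Variables (R : realType) (mu : {content set nat -> \bar R}).
Hypothesis mu_fin : (mu setT < +oo)%E.

Definition mass (A : set nat) : R := fine (mu A).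

Lemma massE A : (mass A)%:E = mu A.
Proof.
rewrite /mass fineK// ge0_fin_numE//.
by apply: le_lt_trans mu_fin; apply: le_measure; rewrite ?inE.
Qed.

Lemma mass_ge0 A : 0 <= mass A.
Proof. by rewrite -lee_fin massE. Qed.

Lemma mass0 : mass set0 = 0.
Proof. by rewrite /mass measure0. Qed.

Lemma massU A B : A `&` B = set0 -> mass (A `|` B) = mass A + mass B.
Proof. by move=> AB; apply: EFin_inj; rewrite EFinD !massE measureU. Qed.

Lemma mass_partition (I : finType) (p : nat -> I) A :
  mass A = \sum_k mass (A `&` p @^-1` [set k]).
Proof.
have H (s : seq I) : uniq s -> mass (A `&` p @^-1` [set` s]) =
    \sum_(k <- s) mass (A `&` p @^-1` [set k]).
  elim: s => [_|k s IH /= /andP[ks us]].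
    rewrite big_nil -[RHS]mass0; congr mass; apply/seteqP; split => // i [] _ /=.
    by rewrite in_nil.
  rewrite big_cons -IH// -massU.
    congr mass; apply/seteqP; split => i /=; rewrite inE.
      by move=> [Ai /predU1P[]]; [left|right].
    by move=> [[Ai ->]|[Ai ->]]; rewrite ?eqxx ?orbT.
  by apply/seteqP; split => // i /= [[_ ->] [_ ks']]; rewrite ks' in ks.
rewrite -[in RHS]big_enum -H ?enum_uniq//; congr mass; apply/seteqP; split => i.
  by move=> Ai; split => //=; rewrite mem_enum.
by case.
Qed.

Definition simple_int (f : nat -> R) : R := fine (sintegral mu f).

(** The simple integral sums over distinct values, whereas [c] may repeat a value: each level set of
    [c \o p] is split into fibres of [p], and the two sums are exchanged. *)
Lemma sintegral_fin (I : finType) (p : nat -> I) (c : I -> R) :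
  sintegral mu (c \o p) = (\sum_k c k * mass (p @^-1` [set k]))%:E.
Proof.
rewrite /sintegral; set s := undup (map c (enum I)).
rewrite (fsbigE s) ?undup_uniq//; last first.
  move=> x _ xs; rewrite (_ : _ @^-1` _ = set0) ?measure0 ?mule0//.
  apply/seteqP; split => // i /= cx; move: xs.
  by rewrite mem_undup -cx map_f// mem_enum.
rewrite (eq_bigr (fun x => (\sum_k (x * (c k == x)%:R) * mass (p @^-1` [set k]))%:E)).
  rewrite (eq_bigl xpredT) => [|x]; last by rewrite in_setT.
  rewrite sumEFin; congr EFin; rewrite exchange_big/=; apply: eq_bigr => k _.
  rewrite -mulr_suml; congr (_ * _).
  rewrite (bigD1_seq (c k)) ?undup_uniq//=; last by rewrite mem_undup map_f// mem_enum.
  rewrite eqxx mulr1 big1 ?addr0// => x xk.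
  by rewrite eq_sym (negbTE xk) mulr0.
move=> x _; rewrite -massE (mass_partition p) -EFinM mulr_sumr; congr EFin.
apply: eq_bigr => k _; rewrite -mulrA; congr (_ * _).
have [ckx|ckx] := eqVneq (c k) x.
  rewrite mul1r; congr mass; apply/seteqP; split => [i []//|i /= pk].
  by split => //=; rewrite pk.
rewrite mul0r -mass0; congr mass; apply/seteqP; split => // i [/= cpx pk].
by move: ckx; rewrite -cpx pk eqxx.
Qed.

Definition simple (f : nat -> R) := finite_set (range f).

(** A common finite partition reduces linearity and monotonicity of the simple integral to finite
    sums over [I]. *)
Lemma simpleP f g : simple f -> simple g ->
  exists (I : finType) (p : nat -> I) (c d : I -> R), f = c \o p /\ g = d \o p.
Proof.
move=> sf sg.
pose s := finmap.enum_fset (fset_set (range f)); pose t := finmap.enum_fset (fset_set (range g)).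
have fs i : f i \in s by rewrite in_fset_set// inE; exists i.
have gt i : g i \in t by rewrite in_fset_set// inE; exists i.
exists ('I_(size s).+1 * 'I_(size t).+1 : finType)%type.
exists (fun i => (inord (index (f i) s), inord (index (g i) t))).
exists (fun k => nth 0 s (k.1 : 'I__)), (fun k => nth 0 t (k.2 : 'I__)).
by split; apply/funext => i /=; rewrite inordK ?nth_index// ltnS index_size.
Qed.

Lemma simple_comp (I : finType) (p : nat -> I) (c : I -> R) : simple (c \o p).
Proof.
rewrite /simple; apply: (@sub_finite_set _ _ (c @` [set: I])).
  by move=> _ [i _ <-] /=; exists (p i).
exact/finite_image/finite_finset.
Qed.

Lemma simple_intE (I : finType) (p : nat -> I) (c : I -> R) :
  simple_int (c \o p) = \sum_k c k * mass (p @^-1` [set k]).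
Proof. by rewrite /simple_int sintegral_fin. Qed.

Lemma simple_intP f : simple f -> sintegral mu f = (simple_int f)%:E.
Proof.
move=> sf; have [I [p [c [_ [-> _]]]]] := simpleP sf sf.
by rewrite /simple_int sintegral_fin.
Qed.

Lemma simple_lin f g (a b : R) : simple f -> simple g ->
  simple (fun i => a * f i + b * g i) /\
  simple_int (fun i => a * f i + b * g i) = a * simple_int f + b * simple_int g.
Proof.
move=> sf sg; have [I [p [c [d [-> ->]]]]] := simpleP sf sg.
have -> : (fun i => a * (c \o p) i + b * (d \o p) i) =
  (fun k => a * c k + b * d k) \o p by [].
split; first exact: simple_comp.
rewrite !simple_intE !mulr_sumr -big_split/=; apply: eq_bigr => k _.
by rewrite mulrDl !mulrA.
Qed.

Lemma simple_int_le f g : simple f -> simple g -> (forall i, f i <= g i) ->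
  simple_int f <= simple_int g.
Proof.
move=> sf sg; have [I [p [c [d [-> ->]]]]] := simpleP sf sg => cd.
rewrite !simple_intE; apply: ler_sum => k _.
have [->|/set0P[i /= pik]] := eqVneq (p @^-1` [set k]) set0.
  by rewrite mass0 !mulr0.
by rewrite ler_wpM2r ?mass_ge0// -pik; exact: cd.
Qed.

Lemma simple_cst (r : R) : simple (fun=> r) /\ simple_int (fun=> r) = r * mass setT.
Proof.
have -> : (fun=> r) = (fun=> r) \o (fun _ : nat => tt) by [].
split; first exact: simple_comp.
rewrite simple_intE (bigD1 tt)//= big1 ?addr0; last by case.
by congr (_ * mass _); apply/seteqP; split.
Qed.

Lemma simple_indic (A : set nat) : simple (fun i => (i \in A)%:R) /\
  simple_int (fun i => (i \in A)%:R) = mass A.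
Proof.
have -> : (fun i => (i \in A)%:R) = (fun b : bool => b%:R) \o (fun i => i \in A) by [].
split; first exact: simple_comp.
rewrite simple_intE big_bool /= mul1r mul0r addr0.
by congr mass; apply/seteqP; split => i /=; [move/set_mem|move/mem_set].
Qed.

Lemma simple_maxr f : simple f -> simple (fun i => Num.max (f i) 0).
Proof.
move=> sf; have [I [p [c [_ [-> _]]]]] := simpleP sf sf.
exact: (simple_comp p (fun k => Num.max (c k) 0)).
Qed.

Definition bndr (f : nat -> R) := exists M : R, forall i, `|f i| <= M.

Lemma simple_bnd f : simple f -> bndr f.
Proof.
move=> sf; have [I [p [c [_ [-> _]]]]] := simpleP sf sf.
exists (\sum_k `|c k|) => i /=.
by rewrite (bigD1 (p i))//= lerDl sumr_ge0.
Qed.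

(** Round [f i / e] down to an integer; boundedness leaves finitely many integers, shifted by [K]
    into an ordinal type. *)
Lemma simple_approx f (e : R) : 0 < e -> bndr f -> exists2 h, simple h &
  forall i, h i <= f i <= h i + e.
Proof.
move=> e0 [M fM].
(* The successor is for negative values: the floor of a number at least - M / e can be as low as
   minus the floor of M / e, minus one. *)
pose K := `|Num.floor (M / e)|.+1.
have fl i : (`|Num.floor (f i / e)| <= K)%N.
  have : `|f i / e| <= M / e.
    by rewrite normrM normfV (gtr0_norm e0) ler_pM2r ?invr_gt0.
  rewrite ler_norml => /andP[fl1 fl2].
  have /andP[m1 m2] := floor_itv (M / e).
  have /andP[g1 g2] := floor_itv (f i / e).
  have M0 : 0 <= Num.floor (M / e).
    by rewrite floor_ge0 divr_ge0 ?(ltW e0)// (le_trans _ (fM 0%N)).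
  have u1 : Num.floor (f i / e) <= Num.floor (M / e) by exact: le_floor.
  have u2 : - (Num.floor (M / e) + 1) <= Num.floor (f i / e).
    rewrite floor_ge_int rmorphN/=; apply: le_trans fl1.
    by rewrite lerN2 ltW.
  rewrite /K; lia.
pose p i : 'I_(K + K).+1 := inord `|Num.floor (f i / e) + K%:Z|.
pose c (k : 'I_(K + K).+1) : R := (k%:R - K%:R) * e.
exists (c \o p); first exact: simple_comp.
move=> i; have -> : (c \o p) i = (Num.floor (f i / e))%:~R * e.
  rewrite /c /p /= inordK; last by move: (fl i); lia.
  congr (_ * _); apply/eqP; rewrite subr_eq; apply/eqP.
  rewrite -[K%:R]/((K%:Z)%:~R) -intrD -[LHS]/((_%:Z)%:~R); congr (_%:~R).
  by move: (fl i); lia.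
have /andP[g1 g2] := floor_itv (f i / e).
rewrite -ler_pdivlMr// g1/= -[X in _ + X]mul1r -mulrDl -ler_pdivrMr//.
by rewrite ltW// (lt_le_trans g2)// intrD.
Qed.


Import HBNNSimple.

Lemma simple_nnsfun h : simple h -> (forall i, 0 <= h i) ->
  exists g : {nnsfun nat >-> R}, HBNNSimple.NonNegSimpleFun.sort g = h.
Proof.
move=> sh h0.
have mh : measurable_fun setT h by [].
pose g : {nnsfun nat >-> R} := HB.pack h (isMeasurableFun.Build _ _ _ _ h mh)
  (FiniteImage.Build _ _ h sh) (isNonNegFun.Build _ _ h h0).
by exists g.
Qed.

(** The supremum is the defining value of the integral of a non-negative function. Simple functions
    below [f] take part in it, those above bound it by monotonicity, and constants on both sides
    make it finite. *)
Lemma nnintegral_sandwich (f : nat -> R) : (forall i, 0 <= f i) -> bndr f ->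
  exists r : R,
  [/\ ereal_sup [set sintegral mu (HBNNSimple.NonNegSimpleFun.sort h) |
        h in [set h : {nnsfun nat >-> R} | forall x,
          ((HBNNSimple.NonNegSimpleFun.sort h x)%:E <= (f x)%:E)%E]] = r%:E,
      forall h, simple h -> (forall i, 0 <= h i <= f i) -> simple_int h <= r &
      forall k, simple k -> (forall i, f i <= k i) -> r <= simple_int k].
Proof.
move=> f0 [M fM]; set S := ereal_sup _.
have Sk k : simple k -> (forall i, f i <= k i) -> (S <= (simple_int k)%:E)%E.
  move=> sk fk; apply: ge_ereal_sup => _ [h /= hf <-].
  have sh : simple (HBNNSimple.NonNegSimpleFun.sort h) by exact: fimfunP.
  rewrite simple_intP// lee_fin; apply: simple_int_le => // i.
  by apply: le_trans (fk i); rewrite -lee_fin.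
have Sh h : simple h -> (forall i, 0 <= h i <= f i) -> ((simple_int h)%:E <= S)%E.
  move=> sh h0f; have [|g gh] := simple_nnsfun sh.
    by move=> i; case/andP: (h0f i).
  apply: ereal_sup_ubound; exists g; last by rewrite gh simple_intP.
  by move=> x /=; rewrite gh lee_fin; case/andP: (h0f x).
have Sfin : S \is a fin_num.
  rewrite fin_real//; apply/andP; split.
    apply: (@lt_le_trans _ _ (simple_int (fun=> 0))%:E); first by rewrite ltNyr.
    by apply: Sh => [|i]; [exact: (simple_cst 0).1|rewrite lexx f0].
  apply: (@le_lt_trans _ _ (simple_int (fun=> M))%:E); last by rewrite ltry.
  by apply: Sk => [|i]; [exact: (simple_cst M).1|rewrite (le_trans (ler_norm _))].
exists (fine S); split; first by rewrite fineK.
- by move=> h sh hf; have := Sh h sh hf; rewrite -(fineK Sfin) lee_fin.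
- by move=> k sk fk; have := Sk k sk fk; rewrite -(fineK Sfin) lee_fin.
Qed.

Definition rint (f : nat -> R) : R := fine (\int[mu]_i (f i)%:E)%E.

Lemma simple_neg h : simple h -> simple (fun i => - h i) /\
  simple_int (fun i => - h i) = - simple_int h.
Proof.
move=> sh; have := simple_lin (-1) 0 sh sh.
rewrite (_ : (fun i => -1 * h i + 0 * h i) = fun i => - h i).
  by rewrite mulN1r mul0r addr0.
by apply/funext => i; rewrite mulN1r mul0r addr0.
Qed.

(** The integral of a signed function is the difference of those of its positive and negative parts.
    If h <= f then the positive part of h lies below that of f and the negative part above, so the
    two one-sided bounds combine. *)
Lemma rint_sandwich f : bndr f ->
  (forall h, simple h -> (forall i, h i <= f i) -> simple_int h <= rint f) /\
  (forall k, simple k -> (forall i, f i <= k i) -> rint f <= simple_int k).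
Proof.
move=> [M fM].
pose fp i := Num.max (f i) 0; pose fn i := Num.max (- f i) 0.
have fp0 i : 0 <= fp i by rewrite le_max lexx orbT.
have fn0 i : 0 <= fn i by rewrite le_max lexx orbT.
have M0 : 0 <= M by apply: le_trans (fM 0%N).
have bfp : bndr fp.
  exists M => i; rewrite ger0_norm// ge_max M0 andbT.
  exact: le_trans (ler_norm _) (fM i).
have bfn : bndr fn.
  exists M => i; rewrite ger0_norm// ge_max M0 andbT.
  by apply: le_trans (fM i); rewrite -normrN ler_norm.
have [r [rE rh rk]] := nnintegral_sandwich fp0 bfp.
have [s [sE sh' sk']] := nnintegral_sandwich fn0 bfn.
have IE : rint f = r - s.
  rewrite /rint /integral /= patch_setT.
  have -> : (fun i => (f i)%:E)^\+%E = fun i => (fp i)%:E.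
    by apply/funext => i; rewrite funeposE /fp -EFin_max.
  have -> : (fun i => (f i)%:E)^\-%E = fun i => (fn i)%:E.
    by apply/funext => i; rewrite funenegE /fn -EFin_max.
  by rewrite rE sE.
have dec h : simple h -> simple_int h =
    simple_int (fun i => Num.max (h i) 0) - simple_int (fun i => Num.max (- h i) 0).
  move=> sh; have := (simple_lin 1 (-1) (simple_maxr sh) (simple_maxr (simple_neg sh).1)).2.
  rewrite mul1r mulN1r => <-; congr simple_int; apply/funext => i.
  rewrite mul1r mulN1r; case: (leP (h i) 0) => h0; case: (leP (- h i) 0); lra.
split=> h sh hf; rewrite IE dec//; apply: lerB.
- apply: rh => [|i]; first exact: simple_maxr.
  by rewrite le_max lexx orbT ge_max le_max hf fp0.
- apply: sk' => [|i]; first exact: simple_maxr (simple_neg sh).1.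
  by rewrite ge_max le_max lerN2 hf/= le_max lexx orbT.
- apply: rk => [|i]; first exact: simple_maxr.
  by rewrite ge_max le_max hf/= le_max lexx orbT.
- apply: sh' => [|i]; first exact: simple_maxr (simple_neg sh).1.
  by rewrite le_max lexx orbT ge_max le_max lerN2 hf fn0.
Qed.

Lemma le_scale_eq (a b C : R) : (forall e, 0 < e -> a <= b + e * C) -> 0 <= C -> a <= b.
Proof.
move=> H C0; apply/ler_addgt0Pr => e e0.
(* [C] may be 0, hence the divisor [C + 1]. *)
have := H (e / (C + 1)) (divr_gt0 e0 (ltr_wpDl C0 ltr01)).
move/le_trans; apply; rewrite lerD2l -mulrA ler_piMr ?(ltW e0)//.
by rewrite mulrC ler_pdivrMr ?ltr_wpDl// mul1r lerDl.
Qed.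

(** With simple u <= f <= u + e and v <= g <= v + e, both sides lie between the integral of a u + b
    v and that plus e (a + b) mu(N); then e tends to 0. Non-negative coefficients keep the
    inequalities in order, and signs are treated afterwards. Passing [h] by a pointwise equation
    lets it be the zero function in [rint_neg]. *)
Lemma rint_comb (f g h : nat -> R) (a b : R) : 0 <= a -> 0 <= b ->
  bndr f -> bndr g -> (forall i, h i = a * f i + b * g i) ->
  bndr h /\ rint h = a * rint f + b * rint g.
Proof.
move=> a0 b0 bf bg hE.
have bh : bndr h.
  have [M fM] := bf; have [N gN] := bg; exists (a * M + b * N) => i.
  by rewrite hE (le_trans (ler_normD _ _))// !normrM (ger0_norm a0) (ger0_norm b0)
    lerD// ler_wpM2l.
split => //.
have [fl fu] := rint_sandwich bf; have [gl gu] := rint_sandwich bg.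
have [hl hu] := rint_sandwich bh.
have C0 : 0 <= (a + b) * mass setT by rewrite mulr_ge0 ?mass_ge0 ?addr_ge0.
apply/eqP; rewrite eq_le; apply/andP; split; apply: (le_scale_eq _ C0) => e e0;
  have [u su ufe] := simple_approx e0 bf; have [v sv vge] := simple_approx e0 bg;
  have [sw wE] := simple_lin a b su sv;
  have [se seE] := simple_cst e; have [c1 c1E] := simple_lin 1 1 su se;
  have [c2 c2E] := simple_lin 1 1 sv se; have [c3 c3E] := simple_lin a b c1 c2.
- apply: (@le_trans _ _ (a * simple_int u + b * simple_int v + e * ((a + b) * mass setT))).
    have -> : a * simple_int u + b * simple_int v + e * ((a + b) * mass setT) =
       a * (1 * simple_int u + 1 * simple_int (fun=> e)) +
       b * (1 * simple_int v + 1 * simple_int (fun=> e)) by rewrite seE; ring.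
    rewrite -c1E -c2E -c3E; apply: hu => // i; rewrite hE !mul1r.
    by rewrite lerD// ler_wpM2l//; [case/andP: (ufe i)|case/andP: (vge i)].
  rewrite lerD2r lerD// ler_wpM2l//; [apply: fl|apply: gl] => // i.
    by case/andP: (ufe i).
  by case/andP: (vge i).
- apply: (@le_trans _ _ (a * simple_int u + b * simple_int v + e * ((a + b) * mass setT))).
    have -> : a * simple_int u + b * simple_int v + e * ((a + b) * mass setT) =
       a * (1 * simple_int u + 1 * simple_int (fun=> e)) +
       b * (1 * simple_int v + 1 * simple_int (fun=> e)) by rewrite seE; ring.
    rewrite -c1E -c2E lerD// ler_wpM2l//; [apply: fu|apply: gu] => // i; rewrite !mul1r.
      by case/andP: (ufe i).
    by case/andP: (vge i).
  rewrite lerD2r -wE; apply: hl => // i; rewrite hE.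
  by rewrite lerD// ler_wpM2l//; [case/andP: (ufe i)|case/andP: (vge i)].
Qed.

Lemma rint_simple f : simple f -> rint f = simple_int f.
Proof.
move=> sf; have [fl fu] := rint_sandwich (simple_bnd sf).
by apply/eqP; rewrite eq_le fl ?fu.
Qed.

Lemma rint_neg f : bndr f -> rint (fun i => - f i) = - rint f.
Proof.
move=> bf; have bnf : bndr (fun i => - f i).
  by have [M fM] := bf; exists M => i; rewrite normrN.
have [_] := @rint_comb f (fun i => - f i) (fun=> 0) 1 1 ler01 ler01 bf bnf
  (fun i => ltac:(by rewrite !mul1r subrr)).
have [s0 s0E] := simple_cst 0.
by rewrite rint_simple// s0E mul0r !mul1r => /eqP; rewrite eq_sym addrC addr_eq0 => /eqP.
Qed.

Lemma rintD f g : bndr f -> bndr g ->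
  rint (fun i => f i + g i) = rint f + rint g.
Proof.
move=> bf bg; have [//|_] := @rint_comb f g (fun i => f i + g i) 1 1 ler01 ler01 bf bg.
  by move=> i; rewrite !mul1r.
by rewrite !mul1r.
Qed.

Lemma rintZ (a : R) f : bndr f -> rint (fun i => a * f i) = a * rint f.
Proof.
have pos b g : 0 <= b -> bndr g -> rint (fun i => b * g i) = b * rint g.
  move=> b0 bg; have [//|_] := @rint_comb g g (fun i => b * g i) b 0 b0 (lexx _) bg bg.
    by move=> i; rewrite mul0r addr0.
  by rewrite mul0r addr0.
move=> bf; have [a0|a0] := leP 0 a; first exact: pos.
have bnf : bndr (fun i => - f i).
  by have [M fM] := bf; exists M => i; rewrite normrN.
rewrite (_ : (fun i => a * f i) = fun i => - a * - f i); last first.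
  by apply/funext => i; rewrite mulrNN.
by rewrite pos ?oppr_ge0 ?(ltW a0)// rint_neg// mulrNN.
Qed.

Lemma rint_le f g : bndr f -> bndr g -> (forall i, f i <= g i) ->
  rint f <= rint g.
Proof.
move=> bf bg fg.
have bnf : bndr (fun i => - f i).
  by have [M fM] := bf; exists M => i; rewrite normrN.
have bgf : bndr (fun i => g i + - f i).
  have [M fM] := bnf; have [N gN] := bg; exists (N + M) => i.
  by rewrite (le_trans (ler_normD _ _))// lerD.
rewrite -subr_ge0 -rint_neg// -rintD//.
have [s0 s0E] := simple_cst 0.
rewrite (_ : 0 = simple_int (fun=> 0)); last by rewrite s0E mul0r.
by apply: (rint_sandwich bgf).1 => // i; rewrite subr_ge0.
Qed.

Lemma rint_cst r : rint (fun=> r) = r * mass setT.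
Proof. by have [s sE] := simple_cst r; rewrite rint_simple. Qed.

Lemma rint_indic (A : set nat) : rint (fun i => (i \in A)%:R) = mass A.
Proof. by have [s sE] := simple_indic A; rewrite rint_simple. Qed.

Lemma mass_finite_set (A : set nat) : (forall i, mu [set i] = 0%E) ->
  finite_set A -> mass A = 0.
Proof.
move=> at0 fA; apply: EFin_inj; rewrite massE.
have -> : A = \bigcup_(i in A) [set i] by rewrite bigcup_imset1 image_id.
by rewrite measure_fin_bigcup//= ?fsbig1// => i j _ _ [k [-> ->]].
Qed.

(** For each e, [f] is at most M on the finite, hence null, set where |f| > e, and at most e
    elsewhere, so its integral is at most e mu(N). Applying this to - f gives the other
    inequality. *)
Lemma rint_null f : (forall i, mu [set i] = 0%E) -> bndr f ->
  (forall e, 0 < e -> finite_set [set i | e < `|f i|]) -> rint f = 0.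
Proof.
move=> at0 bf ff.
suff H g : bndr g -> (forall e, 0 < e -> finite_set [set i | e < `|g i|]) ->
    rint g <= 0.
  apply/eqP; rewrite eq_le H//= -oppr_le0 -rint_neg// H//.
    by have [M fM] := bf; exists M => i; rewrite normrN.
  by move=> e e0; under eq_set do rewrite normrN; exact: ff.
move=> [M gM] fg; apply: (le_scale_eq _ (mass_ge0 setT)) => e e0.
set A := [set i | e < `|g i|].
have [si siE] := simple_indic A; have [se seE] := simple_cst e.
have [sl slE] := simple_lin M 1 si se.
apply: le_trans (_ : simple_int (fun i => M * (i \in A)%:R + 1 * e) <= _); last first.
  by rewrite slE siE seE mass_finite_set ?mulr0 ?mul1r//; exact: fg.
apply: (rint_sandwich _).2 => //; first by exists M.
move=> i; rewrite mul1r; have M0 : 0 <= M by apply: le_trans (gM 0%N).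
have [iA|/negP iA] := boolP (i \in A).
  by rewrite mulr1 (le_trans (ler_norm _))// (le_trans (gM i))// lerDl ltW.
rewrite mulr0 add0r (le_trans (ler_norm _))// leNgt; apply/negP => h.
by apply: iA; rewrite inE.
Qed.

End FiniteContent.

(** * Integration of bounded complex sequences *)

Section ComplexIntegral.
Set Implicit Arguments.
Unset Strict Implicit.
Variables (R : realType) (mu : {content set nat -> \bar R}).
Hypothesis mu_fin : (mu setT < +oo)%E.
Implicit Types f g : nat -> R[i].

Definition bndc f := exists M : R, forall i, `|f i| <= M%:C%C.

Lemma normc_ge_Im (z : R[i]) : `|complex.Im z|%:C%C <= `|z|.
Proof.
case: z => a b; rewrite normc_def /= lecR -sqrtr_sqr ler_wsqrtr//.
by rewrite lerDr sqr_ge0.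
Qed.

Lemma bndc_Re f : bndc f -> bndr (fun i => complex.Re (f i)).
Proof.
move=> [M fM]; exists M => i; rewrite -lecR; apply: le_trans (fM i).
exact: normc_ge_Re.
Qed.

Lemma bndc_Im f : bndc f -> bndr (fun i => complex.Im (f i)).
Proof.
move=> [M fM]; exists M => i; rewrite -lecR; apply: le_trans (fM i).
exact: normc_ge_Im.
Qed.

Lemma CintegralE f : Cintegral mu f =
  Complex (rint mu (fun i => complex.Re (f i))) (rint mu (fun i => complex.Im (f i))).
Proof. by []. Qed.

Lemma bndcZ c f : bndc f -> bndc (fun i => c * f i).
Proof.
move=> [M fM]; exists (complex.Re (`|c| * M%:C%C)) => i.
have M0 : 0 <= M%:C%C by apply: le_trans (fM i).
by rewrite RRe_real ?ger0_real ?mulr_ge0// normrM ler_wpM2l.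
Qed.

Lemma CintegralD f g : bndc f -> bndc g ->
  Cintegral mu (fun i => f i + g i) = Cintegral mu f + Cintegral mu g.
Proof.
move=> bf bg; rewrite !CintegralE.
have -> : (fun i => complex.Re (f i + g i)) = fun i => complex.Re (f i) + complex.Re (g i).
  by apply/funext => i; case: (f i) => ? ?; case: (g i).
have -> : (fun i => complex.Im (f i + g i)) = fun i => complex.Im (f i) + complex.Im (g i).
  by apply/funext => i; case: (f i) => ? ?; case: (g i).
by rewrite !rintD//; auto using bndc_Re, bndc_Im.
Qed.

Lemma CintegralZ c f : bndc f ->
  Cintegral mu (fun i => c * f i) = c * Cintegral mu f.
Proof.
move=> bf; have [bR bI] := (bndc_Re bf, bndc_Im bf).
have bZ a h : bndr h -> bndr (fun i => a * h i).
  by move=> [M hM]; exists (`|a| * M) => i; rewrite normrM ler_wpM2l.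
case: c => a b; rewrite !CintegralE.
have -> : (fun i => complex.Re (Complex a b * f i)) =
    fun i => a * complex.Re (f i) + - b * complex.Im (f i).
  by apply/funext => i; case: (f i) => ? ? /=; rewrite mulNr.
have -> : (fun i => complex.Im (Complex a b * f i)) =
    fun i => a * complex.Im (f i) + b * complex.Re (f i).
  by apply/funext => i; case: (f i).
rewrite !rintD//; try exact: bZ.
by rewrite !rintZ// mulNr.
Qed.

Lemma Cintegral_cst (c : R[i]) : Cintegral mu (fun=> c) = c * (mass mu setT)%:C%C.
Proof.
by rewrite CintegralE !rint_cst//; case: c => a b /=; rewrite /GRing.mul/= /mulc !mulr0 subr0 add0r.
Qed.

Lemma Cintegral_ge0 f : bndc f -> (forall i, 0 <= f i) -> 0 <= Cintegral mu f.
Proof.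
move=> bf f0; rewrite CintegralE lecE/=.
have -> : (fun i => complex.Im (f i)) = fun=> 0.
  by apply/funext => i; move: (f0 i); rewrite lecE => /andP[/eqP].
rewrite rint_cst// mul0r eqxx/=.
rewrite (_ : 0 = rint mu (fun=> 0)); last by rewrite rint_cst// mul0r.
apply: rint_le => //; first by exists 0 => i; rewrite normr0.
  exact: bndc_Re.
by move=> i; move: (f0 i); rewrite lecE => /andP[].
Qed.

(* Rotating the integral to the positive half-line reduces the bound to the
   real part. *)
Lemma norm_Cintegral f (M : R) : (forall i, `|f i| <= M%:C%C) ->
  `|Cintegral mu f| <= (M * mass mu setT)%:C%C.
Proof.
move=> fM; have bf : bndc f by exists M.
set z := Cintegral mu f; have [z0|z0] := eqVneq z 0.
  rewrite z0 normr0 -[0]/(0%:C)%C lecR mulr_ge0 ?mass_ge0// -lecR.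
  exact: le_trans (normr_ge0 _) (fM 0%N).
pose u := z^* / `|z|.
have u1 : `|u| = 1 by rewrite normrM norm_conjC normfV normr_id mulfV ?normr_eq0.
have uz : u * z = `|z|.
  by rewrite /u mulrAC [z^* * z]mulrC -normCK expr2 mulfK ?normr_eq0.
have -> : `|z| = (complex.Re (u * z))%:C%C by rewrite uz RRe_real ?normr_real.
rewrite lecR -CintegralZ// CintegralE/= -rint_cst//.
apply: rint_le => //; [|by exists `|M| => i|move=> i].
  exact/bndc_Re/bndcZ.
rewrite -lecR; apply: le_trans (fM i); rewrite -[leRHS]mul1r -u1 -normrM.
apply: le_trans (normc_ge_Re _); rewrite lecR; exact: ler_norm.
Qed.

Lemma Cintegral_null f : (forall i, mu [set i] = 0%E) -> bndc f ->
  (forall e : R, 0 < e -> finite_set [set i | e%:C%C < `|f i|]) -> Cintegral mu f = 0.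
Proof.
move=> at0 bf ff; rewrite CintegralE !rint_null//.
- exact: bndc_Im.
- move=> e e0; apply: sub_finite_set (ff e e0) => i /= h.
  by apply: lt_le_trans (normc_ge_Im _); rewrite ltcR.
- exact: bndc_Re.
- move=> e e0; apply: sub_finite_set (ff e e0) => i /= h.
  by apply: lt_le_trans (normc_ge_Re _); rewrite ltcR.
Qed.

Lemma Cintegral_atom f (j : nat) : (forall i, i != j -> f i = 0) ->
  Cintegral mu f = f j * (mass mu [set j])%:C%C.
Proof.
move=> fj; have bind (A : set nat) : bndc (fun i => (i \in A)%:R).
  by exists 1 => i; case: (_ \in _); rewrite ?normr0 ?normr1 ?ler01.
have -> : f = fun i => f j * (i \in [set j])%:R.
  apply/funext => i; have [->|ij] := eqVneq i j; first by rewrite mem_set// mulr1.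
  by rewrite fj// memNset ?mulr0//= => /eqP; apply/negP.
rewrite CintegralZ// mem_set// mulr1; congr (_ * _); rewrite CintegralE.
have -> : (fun i => complex.Re (i \in [set j])%:R) = fun i => (i \in [set j])%:R :> R.
  by apply/funext => i; case: (_ \in _).
have -> : (fun i => complex.Im (i \in [set j])%:R) = fun=> 0 :> R.
  by apply/funext => i; case: (_ \in _).
by rewrite rint_indic// rint_cst// mul0r.
Qed.

End ComplexIntegral.

(** * Inner product identities and the Cauchy-Schwarz inequality *)

Section InnerProduct.
Set Implicit Arguments.
Unset Strict Implicit.
Variables (R : realType) (H : hilbertType R).
Implicit Types x y z : H.

Lemma innerDl x y z : '[x + y, z] = '[x, z] + '[y, z].
Proof. exact: linearDl. Qed.
Lemma innerDr x y z : '[x, y + z] = '[x, y] + '[x, z].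
Proof. exact: linearDr. Qed.
Lemma innerBl x y z : '[x - y, z] = '[x, z] - '[y, z].
Proof. exact: linearBl. Qed.
Lemma innerBr x y z : '[x, y - z] = '[x, y] - '[x, z].
Proof. exact: linearBr. Qed.
Lemma inner0l x : '[0, x] = 0. Proof. exact: linear0l. Qed.
Lemma inner0r x : '[x, 0] = 0. Proof. exact: linear0r. Qed.
Lemma innerZl (a : R[i]) x y : '[a *: x, y] = a * '[x, y].
Proof. exact: linearZl_LR. Qed.
Lemma innerZr (a : R[i]) x y : '[x, a *: y] = a^* * '[x, y].
Proof. exact: linearZr_LR. Qed.
Lemma inner_suml (I : Type) (r : seq I) (P : pred I) (F : I -> H) y :
  '[\sum_(i <- r | P i) F i, y] = \sum_(i <- r | P i) '[F i, y].
Proof. exact: linear_sumlz. Qed.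
Lemma inner_sumr (I : Type) (r : seq I) (P : pred I) (F : I -> H) y :
  '[y, \sum_(i <- r | P i) F i] = \sum_(i <- r | P i) '[y, F i].
Proof. exact: linear_sumr. Qed.
Lemma innerC x y : ('[x, y])^* = '[y, x].
Proof. by rewrite [RHS](hermC inner) expr0 mul1r. Qed.

Lemma innerxx_ge0 x : 0 <= '[x, x].
Proof. by rewrite inner_normE exprn_ge0. Qed.

Lemma inner_sub2 x y :
  '[x - y, x - y] = '[x, x] + '[y, y] - ('[x, y] + '[y, x]).
Proof. rewrite innerBl !innerBr; ring. Qed.

Lemma inner_inj x y : (forall z, '[x, z] = '[y, z]) -> x = y.
Proof.
move=> xy; apply/eqP; rewrite -subr_eq0 -normr_eq0.
rewrite -[_ == 0]andTb -[true]/(0 < 2)%N -expf_eq0.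
by rewrite -inner_normE innerBl xy subrr.
Qed.

Lemma Cauchy_Schwarz x y : `|'[x, y]| <= `|x| * `|y|.
Proof.
have [->|y0] := eqVneq y 0; first by rewrite inner0r !normr0 mulr0.
have ny : 0 < `|y| by rewrite normr_gt0.
have ny2 : '[y, y] != 0 by rewrite inner_normE expf_neq0// gt_eqF.
rewrite -ler_sqr ?nnegrE ?mulr_ge0// exprMn -!inner_normE.
(* The component of x orthogonal to y is x - c y; its squared norm being non-negative is the
   inequality. *)
pose c := '[x, y] / '[y, y].
have := innerxx_ge0 (x - c *: y); rewrite inner_sub2 innerZl !innerZr innerZl.
have cE : c * '[y, y] = '[x, y] by rewrite /c mulfVK.
have -> : '[x, x] + c * (c^* * '[y, y]) - (c^* * '[x, y] + c * '[y, x]) =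
    '[x, x] - c * '[y, x] by rewrite mulrCA cE; ring.
have -> : c * '[y, x] = `|'[x, y]| ^+ 2 / '[y, y].
  by rewrite -(innerC x y) /c mulrAC -normCK.
by rewrite subr_ge0 ler_pdivrMr// inner_normE exprn_gt0.
Qed.

Lemma norm_le_inner x (M : R[i]) : 0 <= M ->
  (forall y, `|'[x, y]| <= M * `|y|) -> `|x| <= M.
Proof.
move=> M0 xM; have [->|x0] := eqVneq x 0; first by rewrite normr0.
have nx : 0 < `|x| by rewrite normr_gt0.
by rewrite -(ler_pM2r nx) -expr2 -inner_normE -[leLHS]ger0_norm ?innerxx_ge0.
Qed.

End InnerProduct.

(** * Passing between non-negative elements of [R[i]] and of [R] *)

Section RealEps.
Variable R : realType.

Lemma gt0c (e : R[i]) : 0 < e -> exists2 r : R, 0 < r & e = r%:C%C.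
Proof.
move=> e0; exists (complex.Re e); last by rewrite RRe_real ?gtr0_real.
by move: e0; rewrite ltcE => /andP[].
Qed.

Lemma normc_le_ReIm (z : R[i]) :
  `|z| <= (`|complex.Re z| + `|complex.Im z|)%:C%C.
Proof.
case: z => a b; rewrite normc_def /= lecR.
have ab0 : 0 <= `|a| + `|b| by rewrite addr_ge0.
rewrite -(ger0_norm ab0) -sqrtr_sqr ler_wsqrtr// sqrrD !real_normK ?num_real//.
by rewrite addrAC lerDl mulrn_wge0// mulr_ge0.
Qed.

Lemma ge0c (e : R[i]) : 0 <= e -> exists2 r : R, 0 <= r & e = r%:C%C.
Proof.
move=> e0; exists (complex.Re e); last by rewrite RRe_real ?ger0_real.
by move: e0; rewrite lecE => /andP[].
Qed.

End RealEps.

(** * The Riesz representation theorem *)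

Section Riesz.
Set Implicit Arguments.
Unset Strict Implicit.
Variables (R : realType) (H : hilbertType R).
Implicit Types x y z : H.

Definition rnorm x : R := complex.Re `|x|.

Lemma rnormE x : `|x| = (rnorm x)%:C%C.
Proof. by rewrite RRe_real ?normr_real. Qed.

Lemma rnorm_ge0 x : 0 <= rnorm x. Proof. by rewrite -ler0c -rnormE. Qed.

Lemma inner_rnorm x : '[x, x] = (rnorm x ^+ 2)%:C%C.
Proof. by rewrite inner_normE rnormE -rmorphXn. Qed.

Lemma Cauchy_Schwarz_rnorm x y : `|'[x, y]| <= (rnorm x * rnorm y)%:C%C.
Proof.
have -> : (rnorm x * rnorm y)%:C%C = (rnorm x)%:C%C * (rnorm y)%:C%C :> R[i].
  exact: (rmorphM (real_complex R)).
by rewrite -!rnormE Cauchy_Schwarz.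
Qed.

Lemma ReD (a b : R[i]) : complex.Re (a + b) = complex.Re a + complex.Re b.
Proof. by case: a => ? ?; case: b. Qed.

Lemma ReN (a : R[i]) : complex.Re (- a) = - complex.Re a.
Proof. by case: a. Qed.

Lemma ReRM (r : R) (a : R[i]) : complex.Re (r%:C%C * a) = r * complex.Re a.
Proof. by case: a => a b /=; rewrite mul0r subr0. Qed.

Lemma Re_conj (a : R[i]) : complex.Re (a^*) = complex.Re a.
Proof. by case: a. Qed.

Lemma Re_le_norm (a : R[i]) (M : R) : `|a| <= M%:C%C -> `|complex.Re a| <= M.
Proof. by move=> aM; rewrite -lecR (le_trans (normc_ge_Re _)). Qed.

Variable f : H -> R[i].
Variable C : R.
Hypothesis flin : forall (a : R[i]) x y, f (a *: x + y) = a * f x + f y.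
Hypothesis fC : forall x, `|f x| <= C%:C%C * `|x|.

Let f0 : f 0 = 0.
Proof. by apply/eqP; rewrite -normr_le0; have := fC 0; rewrite normr0 mulr0. Qed.

Let fD x y : f (x + y) = f x + f y.
Proof. by rewrite -[x in LHS]scale1r flin mul1r. Qed.

Let fZ a x : f (a *: x) = a * f x.
Proof. by rewrite -[a *: x]addr0 flin f0 addr0. Qed.

Let q x := rnorm x ^+ 2.

Let qE x : q x = complex.Re '[x, x]. Proof. by rewrite inner_rnorm. Qed.

Let J x := q x - 2 * complex.Re (f x).

(** Complete the square: |x|^2 - 2 C |x| is at least - C^2. *)
Let Jlb x : - C ^+ 2 <= J x.
Proof.
have := fC x; rewrite rnormE -[X in _ <= X](rmorphM (real_complex R)) => /Re_le_norm.
rewrite ler_norml => /andP[_ h].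
rewrite /J /q; have := sqr_ge0 (rnorm x - C); nra.
Qed.

Let J_add x y (t : R) : J (x + t%:C%C *: y) =
  J x + t ^+ 2 * q y + 2 * t * (complex.Re '[x, y] - complex.Re (f y)).
Proof.
rewrite /J !qE fD fZ innerDl !innerDr !innerZl !innerZr -(innerC x y).
have -> : (t%:C%C)^* = t%:C%C :> R[i] by rewrite /Num.conj/= /conjc/= oppr0.
by rewrite !ReD !ReRM Re_conj; ring.
Qed.

Let d := inf (range J).

Let J_inf : has_inf (range J).
Proof.
split; first by exists (J 0), 0.
by exists (- C ^+ 2) => _ [x _ <-]; exact: Jlb.
Qed.

Let dJ x : d <= J x.
Proof. by apply: ge_inf; [exact: J_inf.2|exists x]. Qed.

(** First-order condition at an approximate minimizer: compare [J x] with [J] at x + s y and x - s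
    y, then divide by s. *)
Let near_min x y (s e : R) : 0 < s -> J x <= d + e ->
  `|complex.Re '[x, y] - complex.Re (f y)| <= s * q y + e / s.
Proof.
move=> s0 Je; set w := _ - _.
have := dJ (x + s%:C%C *: y); rewrite J_add -/w => h1.
have := dJ (x + (- s)%:C%C *: y); rewrite J_add -/w => h2.
have qy : 0 <= q y by exact: sqr_ge0.
have [es sE] : exists u, u = e / s by eexists.
have eE : e = es * s by rewrite sE mulfVK// gt_eqF.
rewrite -sE ler_norml; apply/andP; split.
  rewrite -(ler_pM2r s0); nra.
rewrite -(ler_pM2r s0); nra.
Qed.

(** Along the segment from y to x, [J] is quadratic, and its value at the midpoint is the mean of
    the end values minus q (x - y) / 4; that value is at least d. *)
Let parallelogram x y (e : R) : J x <= d + e -> J y <= d + e ->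
  q (x - y) <= 4 * e.
Proof.
move=> Jx Jy; pose m := (2^-1)%:C%C *: (x - y).
have := dJ (y + (2^-1)%:C%C *: (x - y)); rewrite J_add.
have : J x = J (y + 1%:C%C *: (x - y)) by rewrite scale1r addrC subrK.
rewrite J_add; lra.
Qed.

(* The representing vector is the limit of a minimizing sequence of
   [|x|^2 - 2 Re (f x)], which is Cauchy by the parallelogram law. *)
Lemma Riesz : exists z, forall x, f x = '[x, z].
Proof.
(* The tolerance is the square of the step 1/(n+1) used later in [near_min], so that both s q(y) and
   e / s are of order 1/(n+1). *)
have xn n : {x : H | J x <= d + (n.+1%:R^-1) ^+ 2}.
  apply: cid; have e0 : 0 < (n.+1%:R^-1 : R) ^+ 2 by rewrite exprn_gt0 ?invr_gt0.
  by have [_ [x _ <-] /ltW xe] := inf_adherent e0 J_inf; exists x.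
pose u n := sval (xn n).
have uJ n m : (m <= n)%N -> J (u n) <= d + (m.+1%:R^-1) ^+ 2.
  move=> mn; apply: le_trans (svalP (xn n)) _; rewrite lerD2l.
  by rewrite lerXn2r ?nnegrE ?invr_ge0// lef_pV2 ?posrE// ler_nat.
have ucvg : cvgn u.
  apply: cauchy_cvg; apply/cauchy_exP => _ /gt0c[e e0 ->].
  have [m _ mP] := @near_infty_natSinv_lt R (PosNum (divr_gt0 e0 (ltr0n _ 3))).
  exists (u m); exists m => // n /= mn.
  rewrite -ball_normE /= rnormE ltcR.
  have := parallelogram (uJ m m (leqnn _)) (uJ n m mn).
  have := mP m (leqnn _) => /=; have := rnorm_ge0 (u m - u n); rewrite /q.
  have m0 : 0 < m.+1%:R^-1 :> R by rewrite invr_gt0.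
  move=> w0 me w2; have : rnorm (u m - u n) <= 2 * m.+1%:R^-1.
    by rewrite -ler_sqr ?nnegrE ?mulr_ge0 ?(ltW m0)// exprMn -natrX.
  move=> h; apply: le_lt_trans h _; rewrite mulrC -ltr_pdivlMr//.
  apply: lt_le_trans me _; lra.
pose z := limn u; exists z.
have uz (e : R) : 0 < e -> exists n, rnorm (z - u n) < e /\ n.+1%:R^-1 < e.
  move=> e0; have ec : 0 < e%:C%C :> R[i] by rewrite ltcR.
  have /cvgrPdist_lt/(_ _ ec)[m _ mP] : u @ \oo --> z by [].
  have [k _ kP] := @near_infty_natSinv_lt R (PosNum e0).
  exists (maxn m k); split; last exact: (kP _ (leq_maxr _ _)).
  by rewrite -ltcR -rnormE; exact: (mP _ (leq_maxl _ _)).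
have ReE y : complex.Re (f y) = complex.Re '[y, z].
  rewrite -[RHS]Re_conj innerC; apply/eqP; rewrite -subr_eq0 -normr_le0.
  (* The term [rnorm y] accounts for replacing z by [u n]; [q y] and 1 are the two error terms of
     [near_min]. *)
  apply: (@le_scale_eq _ _ _ (rnorm y + q y + 1)) => [e e0|]; last first.
    by rewrite !addr_ge0 ?rnorm_ge0 ?sqr_ge0.
  have [n [zn ne]] := uz e e0.
  have n0 : 0 < n.+1%:R^-1 :> R by rewrite invr_gt0.
  have := near_min y n0 (uJ n n (leqnn _)); rewrite expr2 mulfK ?gt_eqF// => h.
  have : `|complex.Re '[z, y] - complex.Re '[u n, y]| <= rnorm (z - u n) * rnorm y.
    rewrite -ReN -ReD -innerBl; apply: Re_le_norm.
    exact: Cauchy_Schwarz_rnorm.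
  have := rnorm_ge0 y; have : 0 <= q y by exact: sqr_ge0.
  move: h; rewrite !ler_norml => /andP[h1 h2] qy ny /andP[h3 h4].
  have : rnorm (z - u n) * rnorm y <= e * rnorm y by rewrite ler_wpM2r// ltW.
  have : n.+1%:R^-1 * q y <= e * q y by rewrite ler_wpM2r// ltW.
  move: n0 ne h1 h2; move: (n.+1%:R^-1 : R) => s n0 ne h1 h2 h5 h6.
  by apply/andP; split; lra.
(* Complex linearity recovers the imaginary part from the real part at i y. *)
have ImRe (w : R[i]) : complex.Im w = - complex.Re ('i%C * w).
  by case: w => a b /=; rewrite mul0r mul1r sub0r opprK.
by move=> y; apply/eqP; rewrite eq_complex ReE !ImRe -fZ ReE innerZl !eqxx.
Qed.

End Riesz.

(** * Scalar limits along a proper filter *)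

Section Convergence.
Set Implicit Arguments.
Unset Strict Implicit.
Context (R : realType) (I : Type) (F : set_system I) {FF : ProperFilter F}.
Implicit Types (f : I -> R[i]) (l : R[i]).

Lemma cvgc_dist f l : f x @[x --> F] --> (l : R[i]^o) <->
  forall e : R, 0 < e -> \forall x \near F, `|l - f x| < e%:C%C.
Proof.
split=> [h e e0|h].
  by move/(@cvgrPdist_lt _ R[i]^o): h; apply; rewrite ltcR.
by apply/(@cvgrPdist_lt _ R[i]^o) => _ /gt0c[e e0 ->]; exact: h.
Qed.

Lemma cvgc_unique f l1 l2 : f x @[x --> F] --> (l1 : R[i]^o) ->
  f x @[x --> F] --> (l2 : R[i]^o) -> l1 = l2.
Proof. exact: (@cvg_unique R[i]^o). Qed.

(** This is how weak limits are evaluated on the ranges of the [U i]. *)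
Lemma cvgc_near_cst f l c : (\forall x \near F, f x = c) ->
  f x @[x --> F] --> (l : R[i]^o) -> l = c.
Proof.
move=> fc fl; apply: cvgc_unique fl _; apply/cvgc_dist => e e0.
by apply: filterS fc => x ->; rewrite subrr normr0 ltcR.
Qed.

Lemma cvgc_norm_le f l (M : R[i]) : 0 <= M -> (forall x, `|f x| <= M) ->
  f x @[x --> F] --> (l : R[i]^o) -> `|l| <= M.
Proof.
move=> /ge0c[m m0 ->] fM /cvgc_dist fl.
have nl : `|l| = (complex.Re `|l|)%:C%C by rewrite RRe_real ?normr_real.
rewrite nl lecR; apply/ler_addgt0Pr => e e0.
have [x lx] := filter_ex (fl e e0).
rewrite -lecR -nl (rmorphD (real_complex R)) -[in leLHS](subrK (f x) l) addrC.
by apply: le_trans (ler_normD _ _) _; apply: lerD => //; exact: ltW.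
Qed.

Lemma cvgc_ge0 f l : (forall x, 0 <= f x) ->
  f x @[x --> F] --> (l : R[i]^o) -> 0 <= l.
Proof.
move=> f0 /cvgc_dist fl.
have [lR lI] : (forall e, 0 < e -> - e <= complex.Re l) /\
    (forall e, 0 < e -> `|complex.Im l| <= e).
  split=> e e0; have [x /ltW lx] := filter_ex (fl e e0);
    have := f0 x; rewrite lecE => /andP[/eqP /= fI fR].
    have := Re_le_norm lx; rewrite ReD ReN ler_norml => /andP[+ _].
    move=> h; apply: le_trans h _; lra.
  rewrite -lecR; apply: le_trans lx; apply: le_trans (normc_ge_Im _).
  have -> : complex.Im (l - f x) = complex.Im l.
    by rewrite -[RHS]subr0 -[in RHS]fI; case: (l) => ? ?; case: (f x).
  by [].
rewrite lecE; apply/andP; split; last first.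
  by apply/ler_addgt0Pr => e /lR; lra.
by rewrite -normr_le0; apply/ler_addgt0Pr => e /lI; rewrite add0r.
Qed.

End Convergence.

(** * Bounded operators from forms, adjoints and isometries *)

Section Operators.
Set Implicit Arguments.
Unset Strict Implicit.
Variables (R : realType).

Lemma lin_bounded_continuous (V W : normedModType R[i]) (f : V -> W) (C : R[i]) :
  linear f -> 0 <= C -> (forall x, `|f x| <= C * `|x|) -> continuous f.
Proof.
move=> lf C0 fC; pose g : {linear V -> W} := HB.pack f (GRing.isLinear.Build _ _ _ _ _ lf).
rewrite -[f]/(g : V -> W); apply/linear_bounded_continuous/linear_boundedP.
near=> r => x; apply: le_trans (fC x) _; rewrite ler_wpM2r//.
by near: r; apply: nbhs_pinfty_ge; rewrite ger0_real.
Unshelve. all: by end_near. Qed.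

Lemma opnorm_bound (V W : normedModType R[i]) (f : V -> W) (C : R) :
  linear f -> 0 <= C -> (forall x, `|f x| <= C%:C%C * `|x|) -> opnorm f <= C.
Proof.
move=> lf C0 fC; have cf : continuous f.
  by apply: (lin_bounded_continuous lf _ fC); rewrite ler0c.
apply: (opnorm_le lf cf) => x x1; apply: le_trans (fC x) _.
by rewrite -[leRHS]mulr1 ler_wpM2l// ler0c.
Qed.

Variable (H : hilbertType R).
Implicit Types (a b c : bop H) (x y z : H).

Lemma bopN a x : `|a x| <= `|a| * `|x|.
Proof.
rewrite bop_normE; apply: opnormP; [exact: bop_linear|exact: bop_continuous].
Qed.

Lemma bop_norm_le a (C : R[i]) : 0 <= C -> (forall x, `|a x| <= C * `|x|) -> `|a| <= C.
Proof.
move=> /ge0c[r r0 ->] ar; rewrite bop_normE lecR.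
by apply: opnorm_bound => //; exact: bop_linear.
Qed.

Lemma bopD a b x : (a + b) x = a x + b x. Proof. by []. Qed.
Lemma bopDr a x y : a (x + y) = a x + a y. Proof. exact: linearD. Qed.
Lemma bop0 a : a 0 = 0. Proof. exact: linear0. Qed.
Lemma bop_sumr (I : Type) (r : seq I) (P : pred I) (F : I -> H) a :
  a (\sum_(i <- r | P i) F i) = \sum_(i <- r | P i) a (F i).
Proof. exact: linear_sum. Qed.
Lemma bopZr a k x : a (k *: x) = k *: a x. Proof. exact: linearZ. Qed.
Lemma bopZ k a x : (k *: a) x = k *: a x. Proof. by []. Qed.

Lemma bop_sumE (I : Type) (r : seq I) (P : pred I) (T : I -> bop H) x :
  (\sum_(i <- r | P i) T i) x = \sum_(i <- r | P i) T i x.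
Proof. by elim/big_rec2: _ => // i y1 y2 _ <-. Qed.

Lemma bop_inner_inj a b : (forall x y, '[a x, y] = '[b x, y]) -> a = b.
Proof. by move=> ab; apply: bopP => x; apply: inner_inj. Qed.

(** For fixed x the conjugate of s x y is linear and bounded in y, so the Riesz theorem gives the
    value at x; uniqueness of that value gives linearity in x, and the bound on [s] gives
    continuity. *)
Lemma form_op (s : H -> H -> R[i]) (C : R[i]) :
  (forall k x y z, s (k *: x + y) z = k * s x z + s y z) ->
  (forall k x y z, s z (k *: x + y) = k^* * s z x + s z y) ->
  0 <= C ->
  (forall x y, `|s x y| <= C * `|x| * `|y|) ->
  exists b : bop H, forall x y, '[b x, y] = s x y.
Proof.
move=> sl sr C0 sC.
have ex x : {z : H | forall y, '[z, y] = s x y}.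
  apply: cid.
  have /ge0c[D D0 DE] : 0 <= C * `|x| by rewrite mulr_ge0.
  have [] := @Riesz R H (fun y => (s x y)^*) D.
  - by move=> k y z; rewrite sr rmorphD rmorphM /= conjCK.
  - by move=> y; rewrite norm_conjC -DE.
  by move=> z zE; exists z => y; rewrite -innerC -zE conjCK.
pose f x := sval (ex x).
have fE x y : '[f x, y] = s x y by exact: (svalP (ex x)).
have lf : linear f.
  by move=> k x y; apply: inner_inj => z; rewrite innerDl innerZl !fE sl.
have bf : f \in @bounded_operator R H.
  apply/asboolP; split=> //; apply: (lin_bounded_continuous lf C0) => x.
  apply: norm_le_inner => [|y]; first by rewrite mulr_ge0.
  by rewrite fE.
by exists (Bop bf).
Qed.

Lemma adjoint_ex a : exists b, is_adjoint a b.
Proof.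
have [] := @form_op (fun x y => '[x, a y]) `|a|.
- by move=> k x y z; rewrite innerDl innerZl.
- by move=> k x y z; rewrite linearP innerDr innerZr.
- by [].
- move=> x y; rewrite (le_trans (Cauchy_Schwarz _ _))//.
  by rewrite [`|a| * _]mulrC -mulrA ler_wpM2l// bopN.
move=> b bE; exists b => x y.
by rewrite -innerC -bE innerC.
Qed.

Lemma adjointE a x y : '[a x, y] = '[x, adjoint a y].
Proof.
have [b ab] := adjoint_ex a.
exact: (@xgetPex _ (0 : bop H) [set b | is_adjoint a b] (ex_intro _ b ab)).
Qed.

Lemma adjointEl a x y : '[adjoint a x, y] = '[x, a y].
Proof. by rewrite -innerC -adjointE innerC. Qed.

(** Polarization: norms of x + y preserve the sum of the inner product and its conjugate; replacing
    x by i x preserves their difference. *)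
Lemma isometry_inner a : isometry_op a -> forall x y, '[a x, a y] = '[x, y].
Proof.
move=> ia.
have sym x y : '[a x, a y] + '[a y, a x] = '[x, y] + '[y, x].
  have : '[a (x + y), a (x + y)] = '[x + y, x + y] by rewrite !inner_normE ia.
  have n z : '[a z, a z] = '[z, z] by rewrite !inner_normE ia.
  rewrite linearD !innerDl !innerDr !n => h.
  by move: h; rewrite !addrA => /addIr; rewrite -!addrA => /addrI.
move=> x y; have s1 := sym x y; have s2 := sym ('i *: x) y.
move: s2; rewrite linearZ !innerZl !innerZr conjCi !mulNr -!mulrBr.
move=> /(mulfI (neq0Ci _)) s2.
have half (p q : R[i]) : p = ((p + q) + (p - q)) / 2%:R.
  by rewrite addrACA subrr addr0 -mulr2n -[p *+ 2]mulr_natr mulfK ?pnatr_eq0.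
by rewrite (half '[a x, a y] '[a y, a x]) (half '[x, y] '[y, x]) s1; congr ((_ + _) / _).
Qed.

End Operators.

(** * Weak integrals of bounded sequences of operators *)

Section OperatorIntegral.
Set Implicit Arguments.
Unset Strict Implicit.
Variables (R : realType) (H : hilbertType R) (mu : {content set nat -> \bar R}).
Hypothesis mu_fin : (mu setT < +oo)%E.
Implicit Types (x y z : H) (phi : nat -> bop H).

Lemma inner_bop_le phi (M : R) x y : (forall i, `|phi i| <= M%:C%C) ->
  forall i, `|'[phi i x, y]| <= (M * (rnorm x * rnorm y))%:C%C.
Proof.
move=> pM i; have -> : (M * (rnorm x * rnorm y))%:C%C = M%:C%C * ((rnorm x)%:C%C * (rnorm y)%:C%C) :> R[i].
  by rewrite !(rmorphM (real_complex R)).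
rewrite -!rnormE mulrA (le_trans (Cauchy_Schwarz _ _))// ler_wpM2r//.
by rewrite (le_trans (bopN _ _))// ler_wpM2r.
Qed.

Lemma inner_bop_bndc phi (M : R) x y : (forall i, `|phi i| <= M%:C%C) ->
  bndc (fun i => '[phi i x, y]).
Proof. by move=> /inner_bop_le pM; exists (M * (rnorm x * rnorm y)); exact: pM. Qed.

Lemma op_integralP phi (M : R) : (forall i, `|phi i| <= M%:C%C) ->
  is_op_integral mu phi (op_integral mu phi).
Proof.
move=> pM; have bd x y := inner_bop_bndc x y pM.
have M0 : 0 <= M by rewrite -ler0c (le_trans _ (pM 0%N)).
suff [b bE] : exists b, is_op_integral mu phi b.
  exact: (@xgetPex _ (0 : bop H) [set a | is_op_integral mu phi a] (ex_intro _ b bE)).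
have [] := @form_op R H (fun x y => Cintegral mu (fun i => '[phi i x, y])) (M * mass mu setT)%:C%C.
- move=> k x y z; rewrite -CintegralZ// -CintegralD//; last exact: bndcZ.
  by congr Cintegral; apply/funext => i; rewrite linearP innerDl innerZl.
- move=> k x y z; rewrite -CintegralZ// -CintegralD//; last exact: bndcZ.
  by congr Cintegral; apply/funext => i; rewrite innerDr innerZr.
- by rewrite ler0c mulr_ge0 ?mass_ge0.
- move=> x y; apply: le_trans (norm_Cintegral mu_fin (inner_bop_le x y pM)) _.
  by rewrite !rnormE -!(rmorphM (real_complex R)) lecR mulrAC !mulrA.
by move=> b bE; exists b.
Qed.

Lemma op_integral_norm phi (M : R) : (forall i, `|phi i| <= M%:C%C) ->
  `|op_integral mu phi| <= (M * mass mu setT)%:C%C.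
Proof.
move=> pM; have M0 : 0 <= M by rewrite -ler0c (le_trans _ (pM 0%N)).
have C0 : 0 <= (M * mass mu setT)%:C%C :> R[i] by rewrite ler0c mulr_ge0 ?mass_ge0.
apply: bop_norm_le => // x; apply: norm_le_inner => [|y]; first by rewrite mulr_ge0.
rewrite (op_integralP pM); apply: le_trans (norm_Cintegral mu_fin (inner_bop_le x y pM)) _.
by rewrite !rnormE -!(rmorphM (real_complex R)) lecR mulrAC !mulrA.
Qed.

Lemma op_integral_unique phi (M : R) a : (forall i, `|phi i| <= M%:C%C) ->
  is_op_integral mu phi a -> op_integral mu phi = a.
Proof.
by move=> /op_integralP pI ai; apply: bop_inner_inj => x y; rewrite pI ai.
Qed.

End OperatorIntegral.

(** * Relations and estimates for the implementing isometries *)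

Section Implementation.
Set Implicit Arguments.
Unset Strict Implicit.
Variables (R : realType) (H : hilbertType R).
Variables (alpha : bop H -> bop H) (U : nat -> bop H).
Hypothesis hU : implements U alpha.
Implicit Types (a b c : bop H) (x y z : H) (i j k n : nat).

Let W i := adjoint (U i).

Lemma implU_inner i j x y : '[U i x, U j y] = (i == j)%:R * '[x, y].
Proof.
have [iso orth _] := hU; have [<-|ij] := eqVneq i j.
  by rewrite mul1r; exact: isometry_inner.
by rewrite mul0r orth.
Qed.

Lemma implU_norm i x : `|U i x| = `|x|.
Proof. by have [iso _ _] := hU; exact: iso. Qed.

Lemma implWU i j x : W i (U j x) = (i == j)%:R *: x.
Proof.
apply: inner_inj => z.
by rewrite adjointEl implU_inner innerZl eq_sym.
Qed.

Lemma impl_seriesE a n x :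
  series (fun i => U i * a * W i) n x = \sum_(0 <= k < n) U k (a (W k x)).
Proof. by rewrite /series /= bop_sumE. Qed.

Lemma impl_series_inner a n x y :
  '[series (fun i => U i * a * W i) n x, y] = \sum_(0 <= k < n) '[a (W k x), W k y].
Proof.
rewrite impl_seriesE inner_suml; apply: eq_bigr => k _.
by rewrite adjointE.
Qed.

Lemma impl_cvg a x y :
  (\sum_(0 <= k < n) '[a (W k x), W k y]) @[n --> \oo] --> ('[alpha a x, y] : R[i]^o).
Proof.
have [_ _ /(_ a x y)] := hU; rewrite /weak_cvg.
by under eq_cvg do rewrite impl_series_inner.
Qed.

Arguments impl_cvg a x y : clear implicits.

(** Tested against U_i y, only the term k = i of the defining sum survives, so the partial sums are
    constant from n = i + 1 on. *)
Lemma impl_alphaW a i x : W i (alpha a x) = a (W i x).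
Proof.
apply: inner_inj => y; rewrite adjointEl.
apply: (cvgc_near_cst _ (impl_cvg a x (U i y))).
exists i.+1 => // n /= ni.
rewrite (bigD1_seq i) ?iota_uniq ?mem_index_iota//= implWU eqxx scale1r.
rewrite big1 ?addr0// => k ki.
by rewrite implWU (negbTE ki) scale0r inner0r.
Qed.

Lemma impl_alphaU a i x : alpha a (U i x) = U i (a x).
Proof.
apply: inner_inj => y.
apply: (cvgc_near_cst _ (impl_cvg a (U i x) y)).
exists i.+1 => // n /= ni.
rewrite (bigD1_seq i) ?iota_uniq ?mem_index_iota//= implWU eqxx scale1r.
rewrite big1 ?addr0; first by rewrite [RHS]adjointE.
move=> k ki.
by rewrite implWU (negbTE ki) scale0r linear0 inner0l.
Qed.

Lemma sumU_inner (r : seq nat) (v w : nat -> H) : uniq r ->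
  '[\sum_(k <- r) U k (v k), \sum_(k <- r) U k (w k)] = \sum_(k <- r) '[v k, w k].
Proof.
move=> ur; rewrite inner_suml big_seq [RHS]big_seq; apply: eq_bigr => k kr.
rewrite inner_sumr (bigD1_seq k)//= implU_inner eqxx mul1r big1 ?addr0// => j jk.
by rewrite implU_inner eq_sym (negbTE jk) mul0r.
Qed.

(** The vector [p] is the orthogonal projection of x onto the first n ranges, so |x - p|^2 >= 0 is
    the claim. *)
Lemma impl_Bessel n x : \sum_(0 <= k < n) '[W k x, W k x] <= '[x, x].
Proof.
pose p := \sum_(0 <= k < n) U k (W k x); set S := \sum_(0 <= k < n) _.
have pp : '[p, p] = S by rewrite sumU_inner ?iota_uniq.
have px : '[p, x] = S.
  by rewrite inner_suml; apply: eq_bigr => k _; rewrite adjointE.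
have S0 : 0 <= S by apply: sumr_ge0 => k _; exact: innerxx_ge0.
have xp : '[x, p] = S by rewrite -innerC px; apply/CrealP; exact: ger0_real.
have := innerxx_ge0 (x - p); rewrite inner_sub2 pp xp px opprD addrACA subrr addr0.
by rewrite subr_ge0.
Qed.

Lemma implW_norm i x : `|W i x| <= `|x|.
Proof.
rewrite -ler_sqr ?nnegrE// -!inner_normE.
apply: le_trans (impl_Bessel i.+1 x).
by rewrite big_nat_recr//= lerDr sumr_ge0// => k _; exact: innerxx_ge0.
Qed.

(** The terms of a partial sum lie in orthogonal ranges, so its squared norm at x is the sum of the
    |a U_k^* x|^2, at most |a|^2 |x|^2 by [impl_Bessel]; the bound survives the weak limit. *)
Lemma impl_alpha_norm a : `|alpha a| <= `|a|.
Proof.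
apply: bop_norm_le => // x; apply: norm_le_inner => [|y]; first by rewrite mulr_ge0.
apply: (cvgc_norm_le _ _ (impl_cvg a x y)) => [|n].
  by rewrite !mulr_ge0.
pose t := \sum_(0 <= k < n) U k (a (W k x)).
have -> : \sum_(0 <= k < n) '[a (W k x), W k y] = '[t, y].
  by rewrite inner_suml; apply: eq_bigr => k _; rewrite [RHS]adjointE.
apply: le_trans (Cauchy_Schwarz _ _) _; rewrite ler_wpM2r//.
rewrite -ler_sqr ?nnegrE ?mulr_ge0// exprMn -!inner_normE sumU_inner ?iota_uniq//.
apply: le_trans (_ : `|a| ^+ 2 * \sum_(0 <= k < n) '[W k x, W k x] <= _); last first.
  by rewrite ler_wpM2l ?exprn_ge0// impl_Bessel.
rewrite mulr_sumr; apply: ler_sum => k _.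
by rewrite !inner_normE -exprMn ler_sqr ?nnegrE ?mulr_ge0// bopN.
Qed.

Lemma impl_alpha_positive a : positive_op a -> positive_op (alpha a).
Proof.
move=> a0 x; apply: (cvgc_ge0 _ (impl_cvg a x x)) => n.
by apply: sumr_ge0 => k _; exact: a0.
Qed.

Lemma implW_summable v : cvgn (series (fun k => rnorm (W k v) ^+ 2)).
Proof.
apply: nondecreasing_is_cvgn.
  by apply: nondecreasing_series => k _ _; exact: sqr_ge0.
exists (rnorm v ^+ 2) => _ [n _ <-].
rewrite -lecR -inner_rnorm; apply: le_trans (impl_Bessel n v).
rewrite /series/= (rmorph_sum (real_complex R)); apply: ler_sum => k _.
by rewrite inner_rnorm.
Qed.

(** The coefficient equals <x, U_i^* v>, and the squares of |U_i^* v| are summable, hence tend to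
    0. *)
Lemma implU_coef_finite (v x : H) (e : R) : 0 < e ->
  finite_set [set i | e%:C%C < `|'[U i x, v]|].
Proof.
move=> e0; have [->|x0] := eqVneq x 0.
  apply: sub_finite_set (finite_set0 _) => i /=.
  by rewrite linear0 inner0l normr0 ltcR; move/(lt_trans e0); rewrite ltxx.
have rx0 : 0 < rnorm x by rewrite -ltcR -rnormE normr_gt0.
pose g k := rnorm (W k v) ^+ 2.
have gc : cvgn (series g) by exact: implW_summable.
have d0 : 0 < (e / rnorm x) ^+ 2 by rewrite exprn_gt0 ?divr_gt0.
have /cvgrPdist_lt/(_ _ d0)[N _ NP] := cvg_series_cvg_0 gc.
apply: sub_finite_set (finite_II N) => i /= ei; rewrite ltnNge; apply/negP => Ni.
have := NP i Ni; rewrite /= sub0r normrN ger0_norm ?sqr_ge0// /g.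
rewrite ltr_sqr ?nnegrE ?rnorm_ge0 ?divr_ge0 ?ltW//.
rewrite ltr_pdivlMr// => h.
have := lt_le_trans ei (_ : _ <= (rnorm x * rnorm (W i v))%:C%C).
rewrite adjointE => /(_ (Cauchy_Schwarz_rnorm _ _)); rewrite ltcR => h2.
by have := lt_trans h h2; rewrite mulrC ltxx.
Qed.

(* The vectors [U i x] tend weakly to 0, hence a compact operator sends them to
   vectors tending to 0 in norm. *)
Lemma implU_compact_finite a x (e : R) : compact_op a -> `|x| <= 1 -> 0 < e ->
  finite_set [set i | e%:C%C < `|a (U i x)|].
Proof.
move=> ca x1 e0.
have [A A0 AE] : exists2 A, 0 <= A & `|a| = A%:C%C by apply: ge0c.
(* Chosen so that A d + d = e^2, the two contributions to |w|^2 estimated at the end. *)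
pose d := e ^+ 2 / (A + 1).
have A1 : 0 < A + 1 by rewrite ltr_wpDl.
have d0 : 0 < d by rewrite divr_gt0// exprn_gt0.
have d0c : 0 < d%:C%C :> R[i] by rewrite ltcR.
have := ca; rewrite /compact_op precompactE compact_cover.
set K := closure _.
move=> /(_ H setT (fun y : H => ball y d%:C%C)) [].
- by move=> y _; exact: ball_open.
- by move=> y _; exists y => //; exact: ballxx.
move=> D _; set B := (X in cover X _) => KD.
have fB : finite_set B by exact: finite_fset.
(* For w = a U_i x within d of a centre y, smallness of <w, y> would force |w| <= e; so every index
   with |w| > e lies in [F y] for one of the finitely many centres. *)
pose F (y : H) := [set i | d%:C%C < `|'[U i x, adjoint a y]|].
have fF : finite_set (\bigcup_(y in B) F y).
  by apply: bigcup_finite => // y _; exact: implU_coef_finite.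
apply: sub_finite_set fF => i /= ei; have Ux1 : `|U i x| <= 1 by rewrite implU_norm.
have [|y yD] := KD (a (U i x)); first by apply: subset_closure; exists (U i x).
rewrite -ball_normE/= => yi; exists y => //=; rewrite /F/= -adjointE.
set w := a (U i x) in ei yi *.
have wA : rnorm w <= A.
  rewrite -lecR -rnormE -AE; apply: le_trans (bopN _ _) _.
  by rewrite ler_piMr.
rewrite -[X in _ < X]RRe_real ?normr_real// ltcR ltNge; apply/negP => wy.
move: ei; rewrite rnormE ltcR => ei.
have : complex.Re '[w, w] = complex.Re '[w, w - y] + complex.Re '[w, y].
  by rewrite -ReD -innerDr subrK.
rewrite inner_rnorm /=.
have h1 : complex.Re '[w, w - y] <= A * d.
  apply: le_trans (ler_norm _) _.
  apply: Re_le_norm; apply: le_trans (Cauchy_Schwarz_rnorm _ _) _; rewrite lecR.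
  apply: ler_pM => //; try exact: rnorm_ge0.
  by rewrite -lecR -rnormE distrC ltW.
have h2 : complex.Re '[w, y] <= d.
  apply: le_trans (ler_norm _) _; apply: Re_le_norm.
  by rewrite -[leLHS]RRe_real ?normr_real// lecR.
have : (A + 1) * d = e ^+ 2 by rewrite /d mulrC mulfVK// gt_eqF.
have : e ^+ 2 < rnorm w ^+ 2 by rewrite ltr_sqr ?nnegrE ?rnorm_ge0// ltW.
lra.
Qed.

End Implementation.

(** * Compactness of rank-one operators *)

Section RankOne.
Set Implicit Arguments.
Unset Strict Implicit.
Variables (R : realType) (H : hilbertType R).
Implicit Types (x y u : H).

(** The map x |-> <x, u> u sends the unit ball into such a set, with M the norm of u. *)
Lemma segment2_compact (u : H) (M : R) :
  compact ((fun p : R * R => Complex p.1 p.2 *: u) @` (`[- M, M] `*` `[- M, M])).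
Proof.
apply: continuous_compact; last by apply: compact_setX; exact: segment_compact.
apply: continuous_subspaceT => -[s t].
apply/cvgrPdist_lt => _ /gt0c[e e0 ->].
(* The factor 2 covers the real and imaginary parts, and the added 1 covers u = 0. *)
have k0 : 0 < 2 * (rnorm u + 1) by rewrite mulr_gt0// ltr_wpDl ?rnorm_ge0.
have d0 : 0 < e / (2 * (rnorm u + 1)) by rewrite divr_gt0.
set d := e / _ in d0.
have n1 : \forall q \near nbhs ((s, t) : R * R), `|s - q.1| < d.
  have : q.1 @[q --> nbhs ((s, t) : R * R)] --> s by exact: cvg_fst.
  by move/cvgrPdist_lt; apply.
have n2 : \forall q \near nbhs ((s, t) : R * R), `|t - q.2| < d.
  have : q.2 @[q --> nbhs ((s, t) : R * R)] --> t by exact: cvg_snd.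
  by move/cvgrPdist_lt; apply.
apply: filterS2 n1 n2 => -[s' t'] /= h1 h2.
rewrite -scalerBl normrZ.
apply: (@le_lt_trans _ _ ((d + d) * rnorm u)%:C%C).
  rewrite rnormE (rmorphM (real_complex R)) ler_wpM2r ?ler0c ?rnorm_ge0//.
  by apply: le_trans (normc_le_ReIm _) _; rewrite lecR; apply: lerD; exact: ltW.
rewrite ltcR.
have dE : d * (2 * (rnorm u + 1)) = e by rewrite /d mulfVK// gt_eqF.
have : 0 <= rnorm u by exact: rnorm_ge0.
nra.
Qed.

Lemma rank_one_compact u : exists p : bop H,
  (forall x, p x = '[x, u] *: u) /\ compact_op p.
Proof.
have [] := @form_op R H (fun x y => '[x, u] * '[u, y]) (`|u| * `|u|).
- by move=> k x y z; rewrite innerDl innerZl mulrDl mulrA.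
- by move=> k x y z; rewrite innerDr innerZr mulrDr mulrCA.
- by rewrite mulr_ge0.
- move=> x y; rewrite normrM; apply: le_trans (ler_pM _ _ (Cauchy_Schwarz _ _) (Cauchy_Schwarz _ _)) _ => //.
  by rewrite mulrA [`|x| * _]mulrC -!mulrA (mulrCA `|x|).
move=> p pE; have pxE x : p x = '[x, u] *: u.
  by apply: inner_inj => y; rewrite pE innerZl.
exists p; split => //.
apply: (@precompact_subset _ _ _ _ (compact_precompact (@norm_hausdorff _ _)
  (@segment2_compact u (rnorm u)))).
move=> _ [x /= x1 <-]; rewrite pxE.
have cu : `|'[x, u]| <= (rnorm u)%:C%C.
  by rewrite -rnormE; apply: le_trans (Cauchy_Schwarz _ _) _; rewrite ler_piMl.
exists (complex.Re '[x, u], complex.Im '[x, u]); last by case: '[x, u].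
split; rewrite /= in_itv/= -ler_norml -lecR.
  exact: le_trans (normc_ge_Re _) cu.
exact: le_trans (normc_ge_Im _) cu.
Qed.

End RankOne.

(** * Finite orthonormal families *)

Section OrthonormalFamilies.
Set Implicit Arguments.
Unset Strict Implicit.
Variables (R : realType) (H : hilbertType R).
Implicit Types (x y : H) (f : seq H).

Definition onfam f := forall i j, (i < size f)%N -> (j < size f)%N ->
  '[f`_i, f`_j] = (i == j)%:R.

Lemma onfam_proj f x k : onfam f -> (k < size f)%N ->
  '[\sum_(0 <= i < size f) '[x, f`_i] *: f`_i, f`_k] = '[x, f`_k].
Proof.
move=> of_ kf; rewrite inner_suml (bigD1_seq k) ?iota_uniq ?mem_index_iota//=.
rewrite innerZl of_// eqxx mulr1 big_nat_cond big1 ?addr0// => i /andP[/andP[_ i_f] ik].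
by rewrite innerZl of_// (negbTE ik) mulr0.
Qed.

Lemma onfam_Bessel f x : onfam f ->
  \sum_(0 <= i < size f) `|'[x, f`_i]| ^+ 2 <= '[x, x].
Proof.
move=> of_; pose p := \sum_(0 <= i < size f) '[x, f`_i] *: f`_i.
set S := \sum_(0 <= i < size f) _.
have xp : '[x, p] = S.
  by rewrite inner_sumr; apply: eq_bigr => i _; rewrite innerZr mulrC -normCK.
have pp : '[p, p] = S.
  rewrite {2}/p inner_sumr; apply: eq_big_nat => i /andP[_ i_f].
  by rewrite innerZr onfam_proj// mulrC -normCK.
have S0 : 0 <= S by apply: sumr_ge0 => i _; rewrite exprn_ge0.
have px : '[p, x] = S by rewrite -innerC xp; apply/CrealP; exact: ger0_real.
have := innerxx_ge0 (x - p); rewrite inner_sub2 pp xp px opprD addrACA subrr addr0.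
by rewrite subr_ge0.
Qed.

(** The residual [r] of a new vector is orthogonal to the family. If it vanishes the family is kept,
    so dependent vectors are allowed; otherwise its normalization is appended. *)
Lemma Gram_Schmidt (xs : seq H) : exists2 f, onfam f &
  forall x, x \in xs -> x = \sum_(0 <= i < size f) '[x, f`_i] *: f`_i.
Proof.
elim: xs => [|x xs [f of_ fx]]; first by exists [::].
pose r := x - \sum_(0 <= i < size f) '[x, f`_i] *: f`_i.
have rf k : (k < size f)%N -> '[r, f`_k] = 0.
  by move=> kf; rewrite innerBl onfam_proj// subrr.
have [r0|r0] := eqVneq r 0.
  exists f => // y; rewrite inE => /predU1P[->|/fx//].
  by apply/eqP; rewrite -subr_eq0; apply/eqP.
have nr0 : `|r| != 0 by rewrite normr_eq0.
pose u := `|r|^-1 *: r.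
have uf k : (k < size f)%N -> '[u, f`_k] = 0.
  by move=> kf; rewrite innerZl rf// mulr0.
have uu : '[u, u] = 1.
  by rewrite inner_normE normrZ normfV normr_id mulVf// expr1n.
have fu k : (k < size f)%N -> '[f`_k, u] = 0.
  by move=> kf; rewrite -innerC uf// conjC0.
have sum_rcons y : \sum_(0 <= i < size (rcons f u)) '[y, (rcons f u)`_i] *: (rcons f u)`_i =
    \sum_(0 <= i < size f) '[y, f`_i] *: f`_i + '[y, u] *: u.
  rewrite size_rcons big_nat_recr//= nth_rcons ltnn eqxx; congr (_ + _).
  by apply: eq_big_nat => i /andP[_ i_f]; rewrite nth_rcons i_f.
exists (rcons f u).
  move=> i j; rewrite size_rcons !ltnS !nth_rcons.
  rewrite leq_eqVlt => /predU1P[->|i_f]; rewrite leq_eqVlt => /predU1P[->|j_f].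
  - by rewrite ltnn eqxx uu.
  - by rewrite ltnn eqxx j_f uf// (gtn_eqF j_f).
  - by rewrite ltnn eqxx i_f fu// (ltn_eqF i_f).
  - by rewrite i_f j_f of_.
move=> y; rewrite inE sum_rcons => /predU1P[->|yxs]; last first.
  rewrite -fx// [X in _ + X](_ : _ = 0) ?addr0//.
  rewrite {1}(fx y yxs) inner_suml big_nat_cond big1 ?scale0r// => i /andP[/andP[_ i_f] _].
  by rewrite innerZl fu// mulr0.
have -> : '[x, u] = `|r|.
  have -> : x = r + \sum_(0 <= i < size f) '[x, f`_i] *: f`_i by rewrite subrK.
  rewrite innerDl inner_suml [X in _ + X]big_nat_cond [X in _ + X]big1 ?addr0; last first.
    by move=> i /andP[/andP[_ i_f] _]; rewrite innerZl fu// mulr0.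
  rewrite innerZr inner_normE (_ : (_^-1)^* = `|r|^-1); last first.
    by apply/CrealP; rewrite rpredV normr_real.
  by rewrite expr2 mulrA mulVf// mul1r.
by rewrite scalerA mulfV// scale1r addrC subrK.
Qed.

End OrthonormalFamilies.

(** * A uniform bound for finite blocks of matrix coefficients *)

Section MatrixCoefficients.
Set Implicit Arguments.
Unset Strict Implicit.
Variables (R : realType) (H K : hilbertType R) (e : nat -> K).
Hypothesis one : forall i j, '[e i, e j] = (i == j)%:R.
Variable b : bop K.

Lemma sum_e_norm (n : nat) (c : nat -> R[i]) :
  '[\sum_(0 <= j < n) c j *: e j, \sum_(0 <= j < n) c j *: e j] =
  \sum_(0 <= j < n) `|c j| ^+ 2.
Proof.
rewrite inner_suml; apply: eq_big_nat => k /andP[_ kn].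
rewrite inner_sumr (bigD1_seq k) ?iota_uniq ?mem_index_iota//=.
rewrite innerZl innerZr one eqxx mulr1 -normCK big1 ?addr0// => j jk.
by rewrite innerZl innerZr one eq_sym (negbTE jk) !mulr0.
Qed.

(* Expanding the vectors [x j] in a common orthonormal family reduces the
   vector-valued form to a sum of scalar forms of [b]. *)
Lemma coef_form_bound (m n : nat) (x y : nat -> H) :
  `|\sum_(0 <= i < m) \sum_(0 <= j < n) '[b (e j), e i] * '[x j, y i]| <=
  `|b| * ((\sum_(0 <= j < n) '[x j, x j] + \sum_(0 <= i < m) '[y i, y i]) / 2%:R).
Proof.
have [f of_ fx] := Gram_Schmidt (map x (iota 0 n)).
(* Coordinate k of the x j, resp. y i, is gathered into one vector of [K]. The family spans only the
   x j; the part of y i orthogonal to it pairs to 0 with every x j and is discarded by Bessel's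
   inequality at the end. *)
pose xi k := \sum_(0 <= j < n) '[x j, f`_k] *: e j.
pose eta k := \sum_(0 <= i < m) '[y i, f`_k] *: e i.
have -> : \sum_(0 <= i < m) \sum_(0 <= j < n) '[b (e j), e i] * '[x j, y i] =
    \sum_(0 <= k < size f) '[b (xi k), eta k].
  rewrite [RHS](eq_bigr (fun k => \sum_(0 <= i < m) \sum_(0 <= j < n)
      '[b (e j), e i] * ('[x j, f`_k] * '[f`_k, y i]))); last first.
    move=> k _; rewrite /eta inner_sumr; apply: eq_bigr => i _.
    rewrite /xi linear_sum/= inner_suml; apply: eq_bigr => j _.
    by rewrite bopZr innerZr !innerZl innerC; ring.
  rewrite [RHS]exchange_big/=; apply: eq_bigr => i _.
  rewrite [RHS]exchange_big/=; apply: eq_big_nat => j /andP[_ jn].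
  rewrite -mulr_sumr; congr (_ * _).
  rewrite {1}(fx (x j)) ?map_f ?mem_iota// inner_suml.
  by apply: eq_bigr => k _; rewrite innerZl.
apply: le_trans (ler_norm_sum _ _ _) _.
apply: le_trans (_ : \sum_(0 <= k < size f) `|b| * (('[xi k, xi k] + '[eta k, eta k]) / 2%:R) <= _).
  apply: ler_sum => k _; apply: le_trans (Cauchy_Schwarz _ _) _.
  apply: le_trans (_ : `|b| * `|xi k| * `|eta k| <= _); first by rewrite ler_wpM2r// bopN.
  rewrite -mulrA ler_wpM2l// !inner_rnorm !rnormE.
  rewrite -(rmorphM (real_complex R)) -(rmorphD (real_complex R)).
  have -> : 2%:R = (2%:R)%:C%C :> R[i] by rewrite (rmorph_nat (real_complex R)).
  rewrite -(fmorphV (real_complex R)) -(rmorphM (real_complex R)) lecR.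
  have := sqr_ge0 (rnorm (xi k) - rnorm (eta k)).
  nra.
rewrite -mulr_sumr ler_wpM2l// -mulr_suml ler_wpM2r ?invr_ge0 ?ler0n// big_split/=.
apply: lerD; under eq_bigr do rewrite sum_e_norm; rewrite exchange_big/=;
  by apply: ler_sum => j _; exact: onfam_Bessel.
Qed.

End MatrixCoefficients.

(** The hypothesis at x / |x| and y / |y| has right-hand side C; homogeneity does the rest. *)
Lemma sesquilinear_bound (R : realType) (H : hilbertType R)
    (s : H -> H -> R[i]) (C : R[i]) :
  (forall k x y, s (k *: x) y = k * s x y) ->
  (forall k x y, s x (k *: y) = k^* * s x y) ->
  (forall x y, `|s x y| <= C * (('[x, x] + '[y, y]) / 2%:R)) ->
  forall x y, `|s x y| <= C * `|x| * `|y|.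
Proof.
move=> sl sr sC x y.
have [->|x0] := eqVneq x 0.
  by rewrite -(scale0r (0 : H)) sl mul0r scale0r !normr0 mulr0 mul0r.
have [->|y0] := eqVneq y 0.
  by rewrite -(scale0r (0 : H)) sr conjC0 mul0r scale0r !normr0 mulr0.
have nx : 0 < `|x| by rewrite normr_gt0.
have ny : 0 < `|y| by rewrite normr_gt0.
have := sC (`|x|^-1 *: x) (`|y|^-1 *: y).
rewrite !inner_normE !normrZ !normfV !normr_id !mulVf ?gt_eqF// expr1n.
rewrite -[1 + 1]/(2%:R) mulfV ?pnatr_eq0// mulr1 sl sr !normrM norm_conjC !normfV !normr_id.
by rewrite mulrA -invfM mulrC ler_pdivrMr ?mulr_gt0// mulrA.
Qed.

(** Real and imaginary parts are Cauchy, so completeness of [R] applies to each. *)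
Lemma cauchy_complex (R : realType) (f : nat -> R[i]) :
  (forall d : R, 0 < d -> exists N, forall n m, (N <= n)%N -> (N <= m)%N ->
    `|f n - f m| <= d%:C%C) ->
  exists l : R[i], f n @[n --> \oo] --> (l : R[i]^o).
Proof.
move=> fC.
have part (g : nat -> R) : (forall n m, `|g n - g m|%:C%C <= `|f n - f m|) -> cvgn g.
  move=> gf; apply: cauchy_cvg; apply/cauchy_exP => d d0.
  have d2 : 0 < d / 2 by rewrite divr_gt0.
  have [N NP] := fC _ d2; exists (g N); exists N => // n /= Nn.
  rewrite -ball_normE/=; apply: (@le_lt_trans _ _ (d / 2)).
    by rewrite -lecR; apply: le_trans (gf _ _) _; exact: NP.
  by rewrite ltr_pdivrMr// ltr_pMr// ltr1n.
have cR : cvgn (fun n => complex.Re (f n)).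
  by apply: part => n m; rewrite -ReN -ReD; exact: normc_ge_Re.
have cI : cvgn (fun n => complex.Im (f n)).
  apply: part => n m; apply: le_trans (normc_ge_Im _).
  by rewrite lecR; case: (f n) => ? ?; case: (f m).
exists (Complex (limn (fun n => complex.Re (f n))) (limn (fun n => complex.Im (f n)))).
apply/cvgc_dist => d d0; have d2 : 0 < d / 2 by rewrite divr_gt0.
move/cvgrPdist_lt/(_ _ d2): cR => h1; move/cvgrPdist_lt/(_ _ d2): cI => h2.
apply: filterS2 h1 h2 => n; set p := limn _; set q := limn _; move: p q => p q.
case: (f n) => s t /= h1 h2; apply: le_lt_trans (normc_le_ReIm _) _.
by rewrite ltcR [d]splitr; apply: ltrD.
Qed.

(** * Convergence of the double series and its compressions *)

Section Tensor.
Set Implicit Arguments.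
Unset Strict Implicit.
Variables (R : realType) (H K : hilbertType R).
Variables (alpha : bop H -> bop H) (U : nat -> bop H).
Hypothesis hU : implements U alpha.
Variable e : nat -> K.
Hypothesis one : forall i j, '[e i, e j] = (i == j)%:R.
Variable b : bop K.
Implicit Types (x y z : H) (m n : nat).

Let W i := adjoint (U i).

Definition tensor_form m n x y : R[i] :=
  \sum_(0 <= i < m) \sum_(0 <= j < n) '[b (e j), e i] * '[W j x, W i y].

Lemma tensor_formE m n x y :
  '[(\sum_(0 <= i < m) \sum_(0 <= j < n) '[b (e j), e i] *: (U i * W j) : bop H) x, y] =
  tensor_form m n x y.
Proof.
rewrite bop_sumE inner_suml; apply: eq_bigr => i _.
rewrite bop_sumE inner_suml; apply: eq_bigr => j _.
by rewrite bopZ innerZl bop_mulE -[in RHS]adjointE.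
Qed.

Lemma tensor_form_linl m n k x y z :
  tensor_form m n (k *: x + y) z = k * tensor_form m n x z + tensor_form m n y z.
Proof.
rewrite /tensor_form mulr_sumr -big_split/=; apply: eq_bigr => i _.
rewrite mulr_sumr -big_split/=; apply: eq_bigr => j _.
by rewrite bopDr bopZr innerDl innerZl; ring.
Qed.

Lemma tensor_form_linr m n k x y z :
  tensor_form m n z (k *: x + y) = k^* * tensor_form m n z x + tensor_form m n z y.
Proof.
rewrite /tensor_form mulr_sumr -big_split/=; apply: eq_bigr => i _.
rewrite mulr_sumr -big_split/=; apply: eq_bigr => j _.
by rewrite bopDr bopZr innerDr innerZr; ring.
Qed.

Lemma tensor_form0 m n x : tensor_form m n 0 x = 0 /\ tensor_form m n x 0 = 0.
Proof.
split; rewrite /tensor_form; apply: big1 => i _; apply: big1 => j _.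
  by rewrite bop0 inner0l mulr0.
by rewrite bop0 inner0r mulr0.
Qed.

Lemma tensor_form_bound m n x y : `|tensor_form m n x y| <= `|b| * `|x| * `|y|.
Proof.
apply: sesquilinear_bound => {x y} [k x y|k x y|x y].
- by rewrite -[k *: x]addr0 tensor_form_linl (tensor_form0 _ _ _).1 addr0.
- by rewrite -[k *: y]addr0 tensor_form_linr (tensor_form0 _ _ _).2 addr0.
apply: le_trans (coef_form_bound one b m n (W^~ x) (W^~ y)) _.
rewrite ler_wpM2l// ler_wpM2r ?invr_ge0 ?ler0n//.
by apply: lerD; exact: impl_Bessel hU _ _.
Qed.

(** The orthogonal projection onto the span of the first n ranges. *)
Let P n x := \sum_(0 <= k < n) U k (W k x).

Let WP n x i : W i (P n x) = (i < n)%N%:R *: W i x.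
Proof.
rewrite /P bop_sumr; have [i_n|n_i] := ltnP i n.
  rewrite (bigD1_seq i) ?iota_uniq ?mem_index_iota//= (implWU hU) eqxx !scale1r.
  rewrite big1 ?addr0// => k ki.
  by rewrite (implWU hU) eq_sym (negbTE ki) scale0r.
rewrite scale0r big_nat_cond big1// => k /andP[/andP[_ kn] _].
by rewrite (implWU hU) gtn_eqF ?scale0r// (leq_trans kn).
Qed.

Arguments implW_summable {R H alpha U} hU v.

Let P_cauchy x (d : R) : 0 < d -> exists N, forall m n, (N <= m)%N -> (m <= n)%N ->
  rnorm (P n x - P m x) <= d.
Proof.
move=> d0; have s2 : 0 < d ^+ 2 / 2 by rewrite divr_gt0 ?exprn_gt0.
have gc := implW_summable hU x.
have [N _ NP] := (@cvgrPdist_lt _ _ _ _ _ _ _).1 gc _ s2.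
exists N => m n Nm mn.
have PE : rnorm (P n x - P m x) ^+ 2 =
    series (fun k => rnorm (W k x) ^+ 2) n - series (fun k => rnorm (W k x) ^+ 2) m.
  apply: complexI; rewrite -inner_rnorm /P /series/=.
  have tail (V : zmodType) (F : nat -> V) :
      \sum_(0 <= k < n) F k - \sum_(0 <= k < m) F k = \sum_(m <= k < n) F k.
    by rewrite (big_cat_nat (n := m))//= addrAC subrr add0r.
  rewrite !tail.
  rewrite (sumU_inner hU) ?iota_uniq// (rmorph_sum (real_complex R)).
  by apply: eq_bigr => k _; rewrite inner_rnorm.
rewrite -ler_sqr ?nnegrE ?rnorm_ge0 ?(ltW d0)// PE.
have := NP n (leq_trans Nm mn); have := NP m Nm; rewrite /= !ltr_norml.
move=> /andP[h1 h2] /andP[h3 h4]; lra.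
Qed.

(** Cutting the row range at N has the effect of projecting y by [P N]; differences of partial sums
    thus become values of one form at a small vector. *)
Let form_truncr N m n x y : (N <= m)%N ->
  tensor_form m n x (P N y) = tensor_form N n x y.
Proof.
move=> Nm; rewrite /tensor_form (big_cat_nat (n := N))//= [X in _ + X]big_nat_cond.
rewrite [X in _ + X]big1 ?addr0 => [|i /andP[/andP[Ni _] _]].
  apply: eq_big_nat => i /andP[_ iN]; apply: eq_bigr => j _.
  by rewrite WP iN scale1r.
by apply: big1 => j _; rewrite WP ltnNge Ni scale0r inner0r mulr0.
Qed.

Let form_truncl N m n x y : (N <= n)%N ->
  tensor_form m n (P N x) y = tensor_form m N x y.
Proof.
move=> Nn; rewrite /tensor_form; apply: eq_bigr => i _.
rewrite (big_cat_nat (n := N))//= [X in _ + X]big_nat_cond.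
rewrite [X in _ + X]big1 ?addr0 => [|j /andP[/andP[Nj _] _]].
  by apply: eq_big_nat => j /andP[_ jN]; rewrite WP jN scale1r.
by rewrite WP ltnNge Nj scale0r inner0l mulr0.
Qed.

Let tensor_formBr m n x y z :
  tensor_form m n z (x - y) = tensor_form m n z x - tensor_form m n z y.
Proof.
by rewrite addrC -scaleN1r tensor_form_linr rmorphN1 mulN1r addrC.
Qed.

Let tensor_formBl m n x y z :
  tensor_form m n (x - y) z = tensor_form m n x z - tensor_form m n y z.
Proof. by rewrite addrC -scaleN1r tensor_form_linl mulN1r addrC. Qed.

Let form_cauchy x y (d : R) : 0 < d -> exists N, forall m n m' n',
  (N <= m)%N -> (N <= n)%N -> (N <= m')%N -> (N <= n')%N ->
  `|tensor_form m n x y - tensor_form m' n' x y| <= d%:C%C.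
Proof.
move=> d0.
have [B B0 BE] : exists2 B, 0 <= B & `|b| = B%:C%C by apply: ge0c.
(* With projection errors at most d / c, the row and column cuts cost together B (|x| + |y|) d / c,
   at most d / 2; the 1 keeps c positive. *)
pose c := 2 * (B * (rnorm x + rnorm y) + 1).
have c0 : 0 < c by rewrite mulr_gt0// ltr_wpDl// mulr_ge0// addr_ge0 ?rnorm_ge0.
have dc : 0 < d / c by rewrite divr_gt0.
have [Nx NxP] := P_cauchy x dc; have [Ny NyP] := P_cauchy y dc.
pose N := maxn Nx Ny.
have main m n : (N <= m)%N -> (N <= n)%N ->
    `|tensor_form m n x y - tensor_form N N x y| <= (d / 2)%:C%C.
  move=> Nm Nn.
  (* Rows are cut from m to N first, then columns from n to N. *)
  have -> : tensor_form m n x y - tensor_form N N x y =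
      tensor_form m n x (P m y - P N y) + tensor_form N n (P n x - P N x) y.
    rewrite tensor_formBr tensor_formBl !form_truncr// !form_truncl//.
    by rewrite addrA subrK.
  have h1 := NxP N n (leq_maxl _ _) Nn; have h2 := NyP N m (leq_maxr _ _) Nm.
  apply: le_trans (ler_normD _ _) _.
  apply: le_trans (lerD (tensor_form_bound _ _ _ _) (tensor_form_bound _ _ _ _)) _.
  rewrite BE !rnormE -!(rmorphM (real_complex R)) -(rmorphD (real_complex R)) lecR.
  have dE : d / c * c = d by rewrite mulfVK// gt_eqF.
  have nx := rnorm_ge0 x; have ny := rnorm_ge0 y.
  have k1 : B * rnorm x * rnorm (P m y - P N y) <= B * rnorm x * (d / c).
    by rewrite ler_wpM2l// mulr_ge0.
  have k2 : B * rnorm (P n x - P N x) * rnorm y <= B * (d / c) * rnorm y.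
    by rewrite ler_wpM2r// ler_wpM2l.
  have [r rE] : exists r, r = d / c by eexists.
  move: dE k1 k2 dc; rewrite -rE /c => dE k1 k2 r0; rewrite -dE.
  nra.
exists N => m n m' n' Nm Nn Nm' Nn'.
rewrite -[X in `|X|](subrKA (tensor_form N N x y)).
apply: le_trans (ler_normD _ _) _; rewrite [`|_ - tensor_form m' n' x y|]distrC.
apply: le_trans (lerD (main _ _ Nm Nn) (main _ _ Nm' Nn')) _.
by rewrite -(rmorphD (real_complex R)) -splitr.
Qed.

(** The limit is found along the diagonal m = n; [form_cauchy] leaves the four indices independent,
    which carries it over to all large rectangles. *)
Lemma tensor_form_cvg x y : exists l : R[i],
  tensor_form mn.1 mn.2 x y @[mn --> filter_prod \oo \oo] --> (l : R[i]^o).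
Proof.
have [|l ll] := @cauchy_complex R (fun n => tensor_form n n x y).
  move=> d d0; have [N NP] := form_cauchy x y d0.
  by exists N => n m Nn Nm; exact: NP.
exists l; apply/cvgc_dist => d d0; have d2 : 0 < d / 2 by rewrite divr_gt0.
have [N NP] := form_cauchy x y d2.
have [M _ MP] := (cvgc_dist (fun n => tensor_form n n x y) l).1 ll _ d2.
exists ([set m | (N <= m)%N], [set n | (N <= n)%N]); first by split; exists N.
move=> [m n] [/= Nm Nn].
pose k := maxn N M.
rewrite -(subrKA (tensor_form k k x y)); apply: le_lt_trans (ler_normD _ _) _.
rewrite [d]splitr (rmorphD (real_complex R)); apply: ltr_leD.
  by apply: MP; exact: leq_maxr.
by apply: NP => //; exact: leq_maxl.
Qed.

Lemma tensor_ex : exists a : bop H, weak_cvg (filter_prod \oo \oo)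
    (fun mn : nat * nat => \sum_(0 <= i < mn.1) \sum_(0 <= j < mn.2)
       '[b (e j), e i] *: (U i * adjoint (U j))) a.
Proof.
pose s x y := sval (cid (tensor_form_cvg x y)).
have sP x y : tensor_form mn.1 mn.2 x y @[mn --> filter_prod \oo \oo] --> (s x y : R[i]^o).
  exact: (svalP (cid (tensor_form_cvg x y))).
have [] := @form_op R H s `|b|.
- move=> k x y z; apply: (cvgc_unique (sP _ _)).
  under eq_cvg do rewrite tensor_form_linl.
  by apply: (@cvgD _ R[i]^o); [apply: cvgMr|]; exact: sP.
- move=> k x y z; apply: (cvgc_unique (sP _ _)).
  under eq_cvg do rewrite tensor_form_linr.
  by apply: (@cvgD _ R[i]^o); [apply: cvgMr|]; exact: sP.
- by [].
- move=> x y; apply: (cvgc_norm_le _ _ (sP x y)); first by rewrite !mulr_ge0.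
  by move=> [m n]; exact: tensor_form_bound.
move=> a aE; exists a => x y; rewrite aE.
rewrite (_ : (fun i => _) = fun mn => tensor_form mn.1 mn.2 x y); first exact: sP.
by apply/funext => -[m n]; rewrite tensor_formE.
Qed.

Lemma tensor1P : weak_cvg (filter_prod \oo \oo)
    (fun mn : nat * nat => \sum_(0 <= i < mn.1) \sum_(0 <= j < mn.2)
       '[b (e j), e i] *: (U i * adjoint (U j))) (tensor1 U e b).
Proof.
have [a ha] := tensor_ex.
exact: (@xgetPex _ (0 : bop H) [set a | weak_cvg _ _ a] (ex_intro _ a ha)).
Qed.

(** Once both ranges contain k, only the entry (k, k) survives the test on U_k x and U_k y, so the
    rectangle sums are eventually constant. *)
Lemma tensor1_diag k x y :
  '[tensor1 U e b (U k x), U k y] = '[b (e k), e k] * '[x, y].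
Proof.
have h := @tensor1P (U k x) (U k y); apply: (cvgc_near_cst _ h).
exists ([set m | (k < m)%N], [set n | (k < n)%N]).
  by split; exists k.+1.
move=> [m n] [/= km kn].
rewrite tensor_formE /tensor_form.
rewrite (bigD1_seq k) ?iota_uniq ?mem_index_iota//= [X in _ + X]big1 ?addr0; last first.
  move=> i ik; apply: big1 => j _.
  by rewrite [W i (U k y)](implWU hU) (negbTE ik) scale0r inner0r mulr0.
rewrite (bigD1_seq k) ?iota_uniq ?mem_index_iota//= [X in _ + X]big1 ?addr0; last first.
  by move=> j jk; rewrite [W j (U k x)](implWU hU) (negbTE jk) scale0r inner0l mulr0.
by rewrite !(implWU hU) eqxx !scale1r.
Qed.

End Tensor.

(** * The transfer operator, its functional and the conditional expectation *)

Section Transfer.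
Set Implicit Arguments.
Unset Strict Implicit.
Variables (R : realType) (H : hilbertType R).
Variables (alpha : bop H -> bop H) (U : nat -> bop H).
Hypotheses (halpha : endomorphism alpha) (hU : implements U alpha).
Variable mu : {content set nat -> \bar R}.
Hypothesis mu_fin : (mu setT < +oo)%E.
Implicit Types (a b c : bop H) (x y z : H).

Lemma scaler_injl x (k l : R[i]) : x != 0 -> k *: x = l *: x -> k = l.
Proof.
move=> x0 /eqP; rewrite -subr_eq0 -scalerBl scaler_eq0 (negbTE x0) orbF.
by rewrite subr_eq0 => /eqP.
Qed.

Definition compressions a i := adjoint (U i) * a * U i.

Definition transfer a := op_integral mu (compressions a).

Lemma compressionsE a i x y : '[compressions a i x, y] = '[a (U i x), U i y].
Proof. by rewrite /compressions !bop_mulE adjointEl. Qed.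

Lemma bop_rnorm a : exists2 A : R, 0 <= A & `|a| = A%:C%C.
Proof. exact: ge0c. Qed.

Lemma compressions_norm a i : `|compressions a i| <= `|a|.
Proof.
apply: bop_norm_le => // x; rewrite /compressions !bop_mulE.
apply: le_trans (implW_norm hU i _) _; apply: le_trans (bopN _ _) _.
by rewrite (implU_norm hU).
Qed.

Lemma compressions_bnd a x y : bndc (fun i => '[a (U i x), U i y]).
Proof.
have [A A0 AE] := bop_rnorm a.
have h : forall i, `|compressions a i| <= A%:C%C.
  by move=> i; rewrite -AE compressions_norm.
have [M MP] := inner_bop_bndc x y h.
by exists M => i; rewrite -compressionsE.
Qed.

Lemma transferP a : is_op_integral mu (compressions a) (transfer a).
Proof.
have [A A0 AE] := bop_rnorm a.
apply: (@op_integralP _ _ _ mu_fin _ A) => i.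
by rewrite -AE compressions_norm.
Qed.

Lemma transferE a x y :
  '[transfer a x, y] = Cintegral mu (fun i => '[a (U i x), U i y]).
Proof.
by rewrite transferP; congr Cintegral; apply/funext => i; rewrite compressionsE.
Qed.

Lemma transfer_linear : linear transfer.
Proof.
move=> k a b; apply: bop_inner_inj => x y.
rewrite bopD bopZ innerDl innerZl !transferE.
have [ba bb] := (compressions_bnd a x y, compressions_bnd b x y).
rewrite -CintegralZ// -CintegralD//; last exact: bndcZ.
by congr Cintegral; apply/funext => i; rewrite bopD bopZ innerDl innerZl.
Qed.

Lemma transfer_norm a : `|transfer a| <= (mass mu setT)%:C%C * `|a|.
Proof.
have [A A0 AE] := bop_rnorm a.
rewrite AE -(rmorphM (real_complex R)) mulrC.
apply: op_integral_norm => // i; by rewrite -AE compressions_norm.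
Qed.

Lemma mass_ge0c (A : set nat) : 0 <= (mass mu A)%:C%C :> R[i].
Proof. by rewrite ler0c mass_ge0. Qed.

Lemma transfer_continuous : continuous transfer.
Proof.
exact: lin_bounded_continuous transfer_linear (mass_ge0c setT) transfer_norm.
Qed.

Lemma transfer_positive : positive_map transfer.
Proof.
move=> a a0 x; rewrite transferE; apply: Cintegral_ge0 => //.
  exact: compressions_bnd.
Qed.

Lemma transfer_alphal a b : transfer (alpha a * b) = a * transfer b.
Proof.
apply: bop_inner_inj => x y; rewrite transferE bop_mulE [RHS]adjointE transferE.
congr Cintegral; apply/funext => i.
by rewrite bop_mulE -[LHS]adjointEl (impl_alphaW hU) [LHS]adjointE [LHS]adjointEl.
Qed.

(** The transfer identity is one-sided; this is its mirror image, for the right half of the bimodule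
    property of the expectation. *)
Lemma transfer_alphar a b : transfer (a * alpha b) = transfer a * b.
Proof.
apply: bop_inner_inj => x y; rewrite bop_mulE !transferE.
congr Cintegral; apply/funext => i.
by rewrite bop_mulE (impl_alphaU hU).
Qed.

Lemma transfer_operatorP : transfer_operator alpha transfer.
Proof.
split; [exact: transfer_linear|exact: transfer_continuous|exact: transfer_positive|].
exact: transfer_alphal.
Qed.

Lemma transfer1 : transfer 1 = (mass mu setT)%:C%C *: (1 : bop H).
Proof.
apply: bop_inner_inj => x y; rewrite bopZ innerZl transferE mulrC -Cintegral_cst//.
congr Cintegral; apply/funext => i.
by rewrite !bop_oneE (implU_inner hU) eqxx mul1r.
Qed.

Lemma transfer_opnorm (x : H) : x != 0 -> opnorm transfer = mass mu setT.
Proof.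
move=> x0; have nx : 0 < `|x| by rewrite normr_gt0.
apply/eqP; rewrite eq_le; apply/andP; split.
  exact: opnorm_bound transfer_linear (mass_ge0 mu_fin setT) transfer_norm.
rewrite -lecR -(ler_pM2r nx).
have -> : (mass mu setT)%:C%C * `|x| = `|transfer 1 x|.
  by rewrite transfer1 bopZ bop_oneE normrZ ger0_norm ?mass_ge0c.
apply: le_trans (bopN _ _) _; rewrite ler_wpM2r//.
apply: le_trans (opnormP transfer_linear transfer_continuous _) _.
rewrite ler_piMr ?ler0c//.
  exact: opnorm_ge0 transfer_linear transfer_continuous.
by apply: bop_norm_le => // y; rewrite bop_oneE mul1r.
Qed.

Lemma transfer_singular (h : H) : h != 0 ->
  singular_map transfer <-> (forall i, mu [set i] = 0%E).
Proof.
move=> h0; have nh : '[h, h] != 0 by rewrite inner_normE expf_neq0// normr_eq0.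
split=> [sL j|at0 a ca].
  (* By orthogonality of the ranges, <p U_i h, U_i h> vanishes for i other than j and is <h, h>^2 at
     j. *)
  have [p [pE cp]] := rank_one_compact (U j h).
  have : '[transfer p h, h] = 0 by rewrite sL// inner0l.
  rewrite transferE (Cintegral_atom mu_fin (j := j)) => [|i ij]; last first.
    by rewrite pE innerZl (implU_inner hU) (negbTE ij) !mul0r.
  rewrite pE innerZl !(implU_inner hU) eqxx !mul1r => /eqP.
  rewrite !mulf_eq0 (negbTE nh)/= => /eqP/complexI m0.
  by rewrite -(massE mu_fin) m0.
(* Compactness controls only the image of the unit ball; other vectors are rescaled below. *)
have small x : `|x| <= 1 -> transfer a x = 0.
  move=> x1; apply: inner_inj => y; rewrite inner0l transferE.
  apply: Cintegral_null => //; first exact: compressions_bnd.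
  move=> e e0; have y1 : 0 < rnorm y + 1 by rewrite ltr_wpDl ?rnorm_ge0.
  (* By Cauchy-Schwarz the integrand is at most |a U_i x| |y|, so it exceeds e only if |a U_i x|
     exceeds e / (|y| + 1). *)
  have ey : 0 < e / (rnorm y + 1) by rewrite divr_gt0.
  apply: sub_finite_set (implU_compact_finite hU ca x1 ey) => i /= ei.
  have := lt_le_trans ei (Cauchy_Schwarz_rnorm _ _); rewrite ltcR.
  have -> : rnorm (U i y) = rnorm y by rewrite /rnorm (implU_norm hU).
  move=> h1; rewrite rnormE ltcR ltr_pdivrMr//; apply: lt_le_trans h1 _.
  by rewrite ler_wpM2l ?rnorm_ge0// lerDl.
apply: bopP => x; have [->|x0] := eqVneq x 0; first by rewrite bop0.
have nx : `|x| != 0 by rewrite normr_eq0.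
rewrite -[x in LHS](scalerK nx) scalerA mulrC -scalerA bopZr small ?scaler0//.
by rewrite normrZ normfV normr_id mulVf.
Qed.

Section Functional.
Variables (K : hilbertType R) (e : nat -> K).
Hypothesis one : forall i j, '[e i, e j] = (i == j)%:R.

Lemma coef_bnd (b : bop K) : bndc (fun i => '[b (e i), e i]).
Proof.
have [A A0 AE] : exists2 A, 0 <= A & `|b| = A%:C%C by apply: ge0c.
have ne i : `|e i| = 1.
  apply/eqP; rewrite -(@eqrXn2 _ 2)// -inner_normE one eqxx expr1n//.
exists A => i; apply: le_trans (Cauchy_Schwarz _ _) _; rewrite ne mulr1 -AE.
by apply: le_trans (bopN _ _) _; rewrite ne mulr1.
Qed.

Lemma transfer_tensor1 : associated_functional U e transfer (diagonal_functional e mu).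
Proof.
move=> b; apply: bop_inner_inj => x y; rewrite transferE bopZ bop_oneE innerZl.
rewrite mulrC -CintegralZ//; last exact: coef_bnd.
by congr Cintegral; apply/funext => i; rewrite (tensor1_diag hU one) mulrC.
Qed.

(** A nonzero vector of [H] separates the scalar multiples of the identity. *)
Lemma associated_functional_unique (x : H) (L : bop H -> bop H) (om1 om2 : bop K -> R[i]) :
  x != 0 -> associated_functional U e L om1 -> associated_functional U e L om2 ->
  om1 = om2.
Proof.
move=> x0 h1 h2; apply/funext => b; have := h1 b; rewrite h2 => /(congr1 (fun c : bop H => c x)).
by rewrite !bopZ bop_oneE => /(scaler_injl x0).
Qed.

Lemma diagonal_functional_positive : positive_functional (diagonal_functional e mu).
Proof.
split=> [k a b|a a0]; last by apply: Cintegral_ge0 => //; exact: coef_bnd.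
rewrite /diagonal_functional /= -CintegralZ//; last exact: coef_bnd.
rewrite -CintegralD//; [|exact/bndcZ/coef_bnd|exact: coef_bnd].
congr Cintegral; apply/funext => i.
by rewrite -innerZl -innerDl.
Qed.

End Functional.

(** Since alpha(1) fixes the nonzero vector U_0 x, evaluating alpha(mu(N) 1) = alpha(1) there forces
    mu(N) = 1. *)
Lemma transfer_nondegenerate (x : H) : x != 0 ->
  nondegenerate_transfer alpha transfer <-> mass mu setT = 1.
Proof.
move=> x0; have [alin _ _] := halpha.
have aZ k c : alpha (k *: c) = k *: alpha c.
  have a0 : alpha 0 = 0.
    by have := alin 1 0 0; rewrite !scale1r addr0 -{1}[alpha 0]addr0 => /addrI.
  by have := alin k c 0; rewrite a0 !addr0.
rewrite /nondegenerate_transfer transfer1; split=> [|->]; last by rewrite scale1r.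
rewrite aZ => /(congr1 (fun c : bop H => c (U 0%N x))).
rewrite bopZ (impl_alphaU hU) bop_oneE -[X in _ = X]scale1r => h.
apply: complexI; apply: scaler_injl h.
by rewrite -normr_eq0 (implU_norm hU) normr_eq0.
Qed.

Lemma transfer_expectation : mass mu setT = 1 ->
  conditional_expectation (range alpha) (alpha \o transfer).
Proof.
move=> m1; have [alin aM _] := halpha.
have L1 : transfer 1 = 1 by rewrite transfer1 m1 scale1r.
(* Now [transfer] is a left inverse of [alpha], so the composite fixes the range of [alpha]. *)
have Lal c : transfer (alpha c) = c.
  by rewrite -[alpha c]mulr1 transfer_alphal L1 mulr1.
split.
- split; first by move=> k a b /=; rewrite transfer_linear alin.
  by move=> a a0; apply: (impl_alpha_positive hU); exact: transfer_positive.
- move=> a /=; apply: le_trans (impl_alpha_norm hU _) _.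
  by apply: le_trans (transfer_norm a) _; rewrite m1 mul1r.
- by move=> a; exists (transfer a).
- by move=> _ [c _ <-] /=; rewrite Lal.
- move=> a _ [c _ <-] /=; split; first by rewrite transfer_alphal aM.
  by rewrite transfer_alphar aM.
Qed.

(** The factors U_j and U_j^* do not depend on i and leave the integral; what remains is the
    defining weak sum of [alpha] at the operator [transfer a]. *)
Lemma transfer_weak_sum a : weak_sum
  (fun j => op_integral mu (fun i => U j * adjoint (U i) * a * U i * adjoint (U j)))
  (alpha (transfer a)).
Proof.
have -> : (fun j => op_integral mu (fun i => U j * adjoint (U i) * a * U i * adjoint (U j))) =
    fun j => U j * transfer a * adjoint (U j).
  apply/funext => j; have [A A0 AE] := bop_rnorm a.
  apply: (@op_integral_unique _ _ _ mu_fin _ A) => [i|x y].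
    rewrite -AE; apply: bop_norm_le => // x; rewrite !bop_mulE (implU_norm hU).
    apply: le_trans (implW_norm hU i _) _; apply: le_trans (bopN _ _) _.
    by rewrite (implU_norm hU) ler_wpM2l// (implW_norm hU).
  rewrite !bop_mulE adjointE transferE; congr Cintegral; apply/funext => i.
  by rewrite !bop_mulE [RHS]adjointE [RHS]adjointEl.
by have [_ _] := hU; exact.
Qed.

End Transfer.

Theorem theorem3p6 (R : realType) (H Hinf : hilbertType R)
    (sepH : separable_space H) (infH : infinite_dimensional H)
    (e : nat -> Hinf) (he : hilbert_basis e)
    (alpha : bop H -> bop H) (halpha : endomorphism alpha)
    (U : nat -> bop H) (hU : implements U alpha)
    (mu : {content set nat -> \bar R}) (hmu : (mu setT < +oo)%E) :
  let phi (a : bop H) := fun i => adjoint (U i) * a * U i in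
  let L (a : bop H) := op_integral mu (phi a) in
  [/\ (forall a, is_op_integral mu (phi a) (L a)) /\ transfer_operator alpha L,
      (opnorm L)%:E = mu setT,
      singular_map L <-> (forall i, mu [set i] = 0),
      exists omega : bop Hinf -> R[i],
        [/\ associated_functional U e L omega,
            forall omega', associated_functional U e L omega' -> omega' = omega,
            positive_functional omega,
            diagonalizable_functional omega
          & forall b, omega b = Cintegral mu (fun i => '[b (e i), e i])]
    & (nondegenerate_transfer alpha L <-> mu setT = 1%E) /\
      (nondegenerate_transfer alpha L ->
        conditional_expectation (range alpha) (alpha \o L) /\
        forall a, weak_sum
          (fun j => op_integral mu
             (fun i => U j * adjoint (U i) * a * U i * adjoint (U j)))
          (alpha (L a)))].
Proof.
(* Infinite dimension for the empty family provides a vector different from the empty sum 0. *)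
move=> phi L; have [x x0] : exists x : H, x != 0.
  have [x xP] := infH 0%N (fun=> 0); exists x.
  by have := xP (fun=> 0); rewrite big_ord0.
have [one _] := he.
have nd : nondegenerate_transfer alpha L <-> mu setT = 1%E.
  apply: (iff_trans (transfer_nondegenerate halpha hU hmu x0)).
  by rewrite -(massE hmu); split=> [->//|[]].
split.
- by split; [exact (transferP hU hmu)|exact (transfer_operatorP hU hmu)].
- by rewrite -(massE hmu); congr EFin; exact (transfer_opnorm hU hmu x0).
- exact (transfer_singular hU hmu x0).
- have om := transfer_tensor1 hU hmu one.
  exists (diagonal_functional e mu); split => //.
  + by move=> om' hom'; exact (associated_functional_unique x0 hom' om).
  + exact (diagonal_functional_positive hmu one).
  + by exists e, mu.
- split=> // /nd; rewrite -(massE hmu) => -[m1]; split.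
    exact (transfer_expectation halpha hU hmu m1).
  by move=> a; exact (@transfer_weak_sum _ _ _ _ hU _ hmu a).
Qed.
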